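(* Let $\alpha>0$, $\beta>0$, $n\ge1$, and take $A=0$, $B=1$, so that $D_n(t)=\frac{1}{n!}\int_{[t,1]^n}\prod_{1\le i<j\le n}(x_j-x_i)^2\prod_{k=1}^n x_k^{\alpha}(1-x_k)^{\beta}\,dx_k$. Then, as $t\to1^-$, $$\frac{D_n(t)}{D_n(0)}\sim 2^{2n\alpha}\,\frac{F(0,\beta)\,K(0,\beta,n)}{F(\alpha,\beta)\,K(\alpha,\beta,n)}\,(1-t)^{n(n+\beta)},$$ (i.e. the ratio of the two sides tends to $1$), where $$F(\alpha,\beta)=\frac{\Gamma\big(\tfrac{\alpha+\beta+1}{2}\big)\,G^2\big(\tfrac{\alpha+\beta+1}{2}\big)\,G^2\big(1+\tfrac{\alpha+\beta}{2}\big)}{G(\alpha+\beta+1)\,G(\alpha+1)\,G(\beta+1)},$$ $$K(\alpha,\beta,n)=\frac{G(n+1)\,G(n+\alpha+1)\,G(n+\beta+1)\,G(n+\alpha+\beta+1)}{G^2\big(n+\tfrac{\alpha+\beta+1}{2}\big)\,G^2\big(n+1+\tfrac{\alpha+\beta}{2}\big)\,\Gamma\big(n+\tfrac{\alpha+\beta+1}{2}\big)}.$$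
   Context: $\Gamma$ is the Gamma function and $G$ is the Barnes $G$-function, defined by $G(x+1)=(2\pi)^{x/2}e^{-(x(x+1)+\gamma x^2)/2}\prod_{k=1}^{\infty}\big[(1+x/k)^k e^{-x+x^2/(2k)}\big]$, with $\gamma$ the Euler–Mascheroni constant. $D_n(0)=\frac1{n!}\int_{[0,1]^n}\prod_{i<j}(x_j-x_i)^2\prod_k x_k^\alpha(1-x_k)^\beta dx_k$; the quotient $D_n(t)/D_n(0)$ is the probability that the smallest eigenvalue of the $n\times n$ Jacobi unitary ensemble with weight $x^\alpha(1-x)^\beta$ on $[0,1]$ is at least $t$. *)

(* Defs.v *)
From Stdlib Require Import Reals Lra Lia Arith Factorial List Classical ClassicalEpsilon.
Open Scope R_scope.

Definition lim_seq (u : nat -> R) : R :=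
  match excluded_middle_informative (exists l, Un_cv u l) with
  | left H => proj1_sig (constructive_indefinite_description _ H)
  | right _ => 0
  end.

(* Real power with x^a := 0 for x <= 0 (used only with a > 0, x in [0,1]). *)
Definition powr (x a : R) : R := if Rle_dec x 0 then 0 else Rpower x a.

(* Gamma function for x > 0, via Gauss' limit formula
   Gamma(x) = lim m! m^x / (x (x+1) ... (x+m)). *)
Definition Gamma (x : R) : R :=
  lim_seq (fun m => INR (fact (S m)) * Rpower (INR (S m)) x
                    / prod_f_R0 (fun k => x + INR k) (S m)).

Definition euler_gamma : R :=
  lim_seq (fun m => sum_f_R0 (fun k => / INR (S k)) m - ln (INR (S m))).

(* Barnes G-function: G(x+1) = (2pi)^{x/2} e^{-(x(x+1)+gamma x^2)/2}
   prod_{k>=1} (1+x/k)^k e^{-x+x^2/(2k)}; here BarnesG y = G(y), x = y - 1. *)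
Definition BarnesG (y : R) : R :=
  let x := y - 1 in
  Rpower (2 * PI) (x / 2) * exp (- (x * (x + 1) + euler_gamma * x ^ 2) / 2) *
  lim_seq (fun m => prod_f_R0
     (fun k => (1 + x / INR (S k)) ^ (S k) * exp (- x + x ^ 2 / (2 * INR (S k)))) m).

Definition integral (g : R -> R) (a b : R) : R :=
  match excluded_middle_informative (exists _ : Riemann_integrable g a b, True) with
  | left H => RiemannInt (proj1_sig (constructive_indefinite_description _ H))
  | right _ => 0
  end.

Fixpoint iter_int (n : nat) (a b : R) (f : list R -> R) : R :=
  match n with
  | O => f nil
  | S m => integral (fun x => iter_int m a b (fun l => f (x :: l))) a b
  end.

Fixpoint vdm2 (l : list R) : R :=
  match l with
  | nil => 1
  | x :: r => fold_right (fun y acc => (y - x) ^ 2 * acc) 1 r * vdm2 r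
  end.

Definition jacobi_wt (alpha beta : R) (l : list R) : R :=
  fold_right (fun x acc => powr x alpha * powr (1 - x) beta * acc) 1 l.

Definition Dn (n : nat) (alpha beta t : R) : R :=
  / INR (fact n) * iter_int n t 1 (fun l => vdm2 l * jacobi_wt alpha beta l).

Definition Ffun (a b : R) : R :=
  Gamma ((a + b + 1) / 2) * BarnesG ((a + b + 1) / 2) ^ 2 * BarnesG (1 + (a + b) / 2) ^ 2
  / (BarnesG (a + b + 1) * BarnesG (a + 1) * BarnesG (b + 1)).

Definition Kfun (a b : R) (n : nat) : R :=
  let N := INR n in
  BarnesG (N + 1) * BarnesG (N + a + 1) * BarnesG (N + b + 1) * BarnesG (N + a + b + 1)
  / (BarnesG (N + (a + b + 1) / 2) ^ 2 * BarnesG (N + 1 + (a + b) / 2) ^ 2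
     * Gamma (N + (a + b + 1) / 2)).

Definition asym_rhs (n : nat) (alpha beta t : R) : R :=
  Rpower 2 (2 * INR n * alpha) *
  (Ffun 0 beta * Kfun 0 beta n / (Ffun alpha beta * Kfun alpha beta n)) *
  Rpower (1 - t) (INR n * (INR n + beta)).

(* Main.v *)
(* Substituting x = t + (1 - t) y in every variable gives
   D_n(t) = (1 - t)^(n (n + beta)) det (m_(i+j)(t)) with
   m_k(t) = int_0^1 y^k (t + (1 - t) y)^alpha (1 - y)^beta dy, and m_k(t) tends to
   B(k + 1, beta + 1) as t -> 1.  Hence the quotient is asymptotic to
   H_n(0, beta) / H_n(alpha, beta) (1 - t)^(n (n + beta)), where
   H_n(a, b) = det (B(a + i + j + 1, b + 1)).  Integration by parts shows that replacing
   row i by (a + i) row (i-1) - (a + b + 1 + i) row i clears the first column, so H_n(a, b)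
   reduces to H_(n-1)(a + 1, b + 1) and is a product of n Gamma quotients.  The recurrences
   of Gamma and G together with the duplication formula for Gamma identify this product with
   F(a, b) K(a, b, n), up to 2^(2 n a) and a factor independent of a. *)

Require Import Defs.
From Stdlib Require Import Reals Lra Lia Factorial ClassicalEpsilon FunctionalExtensionality.
From Coquelicot Require Import Coquelicot.
Open Scope R_scope.

(** * The Gamma function *)

(** [Gamma] and [BarnesG] are built on [lim_seq], which returns 0 for a divergent sequence, so
    convergence has to precede every identity. It is proved for logarithms, whose series have terms
    of order 1/k^2; the functional equations are limits of exact relations between the approximants.
    The constants of Stirling and Legendre enter as limits of sequences free of x: the first cancels
    in each quotient of consecutive [Kfun] values, the second between the parameters (0, beta) and
    (alpha, beta). As [Gamma] is Gauss' limit rather than Euler's integral, the Beta integral is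
    tied to it by its recurrence in a and by the behaviour of B(m + a + 1, b + 1) / B(m + 1, b + 1)
    for large m. The case a = 0, which describes the limit t -> 1, needs separate care: [powr 0 0]
    is 0, so [powr x 0] jumps at the left endpoint. Neither Fubini nor a multidimensional
    substitution occurs: expanding the squared Vandermonde determinant over pairs of permutations
    reduces everything to one-dimensional integrals. *)

Lemma lim_seq_eq (u : nat -> R) (l : R) : is_lim_seq u l -> lim_seq u = l.
Proof.
  intros H; apply is_lim_seq_Reals in H.
  unfold lim_seq; destruct (excluded_middle_informative _) as [E|N].
  - destruct (constructive_indefinite_description _ E) as [l' Hl']; simpl.
    exact (UL_sequence _ _ _ Hl' H).
  - exfalso; apply N; now exists l.
Qed.

Lemma is_lim_seq_exp (u : nat -> R) (l : R) :
  is_lim_seq u l -> is_lim_seq (fun m => exp (u m)) (exp l).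
Proof.
  intros H; apply is_lim_seq_continuous; [|exact H].
  apply derivable_continuous, derivable_exp.
Qed.

Lemma is_lim_seq_eq (u : nat -> R) (l l' : R) :
  is_lim_seq u l -> is_lim_seq u l' -> l = l'.
Proof.
  intros H H'; apply is_lim_seq_unique in H; apply is_lim_seq_unique in H'.
  rewrite H in H'; now injection H'.
Qed.

Lemma is_lim_seq_inv_S : is_lim_seq (fun m => / INR (S m)) 0.
Proof.
  apply (is_lim_seq_incr_1 (fun n => / INR n)).
  replace (Finite 0) with (Rbar_inv p_infty) by reflexivity.
  apply is_lim_seq_inv; [apply is_lim_seq_INR|discriminate].
Qed.

Lemma INR_S_pos (m : nat) : 0 < INR (S m).
Proof. apply lt_0_INR; lia. Qed.

Lemma ex_series_inv_sqr : ex_series (fun k => / INR (S k) ^ 2).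
Proof.
  apply (@ex_series_le R_AbsRing R_CompleteNormedModule _
           (fun k => 2 * (/ INR (S k) - / INR (S (S k))))).
  - intros k; change (norm (/ INR (S k) ^ 2)) with (Rabs (/ INR (S k) ^ 2)).
    pose proof (INR_S_pos k) as Hk.
    rewrite Rabs_pos_eq by (left; apply Rinv_0_lt_compat, pow_lt, Hk).
    rewrite (S_INR (S k)); set (x := INR (S k)) in *.
    assert (1 <= x) by (unfold x; rewrite S_INR; pose proof (pos_INR k); lra).
    replace (2 * (/ x - / (x + 1))) with (/ x ^ 2 + (x - 1) / (x ^ 2 * (x + 1)))
      by (field; lra).
    assert (0 <= (x - 1) / (x ^ 2 * (x + 1))); [|lra].
    apply Rmult_le_pos; [lra|left; apply Rinv_0_lt_compat].
    apply Rmult_lt_0_compat; [apply pow_lt|]; lra.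
  - apply (ex_series_scal 2 (fun k => / INR (S k) - / INR (S (S k)))).
    exists (1 - 0).
    change (is_lim_seq (sum_n (fun k => / INR (S k) - / INR (S (S k)))) (1 - 0)).
    apply (is_lim_seq_ext (fun m => 1 - / INR (S (S m)))).
    + intros m; symmetry; induction m as [|m IH].
      * rewrite sum_O; simpl; field.
      * rewrite sum_Sn, IH; unfold plus; simpl plus.
        change (1 - / INR (S (S m)) + (/ INR (S (S m)) - / INR (S (S (S m))))
                = 1 - / INR (S (S (S m)))); ring.
    + apply is_lim_seq_minus'; [apply is_lim_seq_const|].
      apply (is_lim_seq_incr_1 (fun m => / INR (S m))), is_lim_seq_inv_S.
Qed.

Lemma sum_inv_sqr_bound_cv (a : nat -> R) (C : R) :
  (forall k, Rabs (a k) <= C / INR (S k) ^ 2) ->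
  exists l : R, is_lim_seq (sum_f_R0 a) l.
Proof.
  intros Ha.
  assert (E : ex_series a).
  { apply (@ex_series_le R_AbsRing R_CompleteNormedModule a
             (fun k => C * / INR (S k) ^ 2)); [exact Ha|].
    apply (ex_series_scal C (fun k => / INR (S k) ^ 2)), ex_series_inv_sqr. }
  destruct E as [l Hl]; exists l.
  apply (is_lim_seq_ext (sum_n a)); [intros; apply sum_n_Reals|exact Hl].
Qed.

Lemma ln_le_sub_1 (x : R) : 0 < x -> ln x <= x - 1.
Proof.
  intros Hx; pose proof (exp_ineq1_le (ln x)) as H.
  rewrite exp_ln in H by exact Hx; lra.
Qed.

Lemma ln_1p_bounds (u : R) : -1 < u -> u - u ^ 2 / (1 + u) <= ln (1 + u) <= u.
Proof.
  intros Hu; split.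
  - assert (H : 0 < / (1 + u)) by (apply Rinv_0_lt_compat; lra).
    apply ln_le_sub_1 in H; rewrite ln_Rinv in H by lra.
    replace (u - u ^ 2 / (1 + u)) with (1 - / (1 + u)) by (field; lra); lra.
  - pose proof (ln_le_sub_1 (1 + u)); lra.
Qed.

(** Keeps 1 / (1 + u) bounded uniformly for u between 0 and x, in particular for all u = x / (k +
    1), so the constants in the O(1/k^2) bounds do not depend on k. *)
Lemma inv_min_1 (x u : R) : -1 < x -> 0 <= u \/ x <= u -> / (1 + u) <= 1 + / (1 + x).
Proof.
  intros Hx Hu.
  assert (0 < / (1 + x)) by (apply Rinv_0_lt_compat; lra).
  destruct Hu.
  - apply Rle_trans with (/ 1); [apply Rinv_le_contravar; lra|lra].
  - apply Rle_trans with (/ (1 + x)); [apply Rinv_le_contravar; lra|lra].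
Qed.

(** Mean value theorem: the derivative of the left-hand expression is v^2 / (1 + v). Third order is
    required because the Barnes series multiplies this remainder by k + 1. *)
Lemma ln_1p_taylor2 (u : R) :
  -1 < u -> Rabs (ln (1 + u) - u + u ^ 2 / 2) <= Rabs u ^ 3 * (1 + / (1 + u)).
Proof.
  intros Hu.
  destruct (MVT_gen (fun v => ln (1 + v) - v + v ^ 2 / 2) 0 u
              (fun v => v ^ 2 / (1 + v))) as [c [Hc E]].
  - intros v Hv.
    assert (-1 < v) by (destruct (Rle_dec 0 u);
      [rewrite Rmin_left in Hv by lra|rewrite Rmin_right in Hv by lra]; lra).
    auto_derive; [lra|field; lra].
  - intros v Hv.
    assert (-1 < v) by (destruct (Rle_dec 0 u);
      [rewrite Rmin_left in Hv by lra|rewrite Rmin_right in Hv by lra]; lra).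
    apply continuity_pt_filterlim,
      (ex_derive_continuous (fun v => ln (1 + v) - v + v ^ 2 / 2)).
    auto_derive; lra.
  - replace (ln (1 + u) - u + u ^ 2 / 2) with (c ^ 2 / (1 + c) * (u - 0)).
    2:{ rewrite <- E, Rplus_0_r, ln_1; simpl; lra. }
    assert (Hc' : Rabs c <= Rabs u /\ (0 <= c \/ u <= c) /\ -1 < c).
    { destruct (Rle_dec 0 u).
      - rewrite Rmin_left, Rmax_right in Hc by lra.
        rewrite !Rabs_pos_eq by lra; lra.
      - rewrite Rmin_right, Rmax_left in Hc by lra.
        rewrite !Rabs_left1 by lra; lra. }
    destruct Hc' as (H1 & H2 & H3).
    pose proof (inv_min_1 u c Hu H2) as H4.
    assert (0 < / (1 + c)) by (apply Rinv_0_lt_compat; lra).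
    rewrite Rminus_0_r; unfold Rdiv; rewrite !Rabs_mult, <- RPow_abs, (Rabs_pos_eq (/ (1 + c))) by lra.
    replace (Rabs u ^ 3 * (1 + / (1 + u))) with (Rabs u ^ 2 * (1 + / (1 + u)) * Rabs u) by ring.
    apply Rmult_le_compat_r; [apply Rabs_pos|].
    apply Rmult_le_compat; try lra.
    + apply pow_le, Rabs_pos.
    + apply pow_incr; split; [apply Rabs_pos|lra].
Qed.

Lemma div_S_bounds (x : R) (k : nat) :
  -1 < x -> -1 < x / INR (S k) /\ (0 <= x / INR (S k) \/ x <= x / INR (S k)).
Proof.
  intros Hx.
  assert (Hk : 0 < / INR (S k) <= 1).
  { pose proof (INR_S_pos k); split; [now apply Rinv_0_lt_compat|].
    rewrite <- Rinv_1; apply Rinv_le_contravar; [lra|].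
    rewrite S_INR; pose proof (pos_INR k); lra. }
  unfold Rdiv; destruct (Rle_dec 0 x).
  - assert (0 <= x * / INR (S k)) by (apply Rmult_le_pos; lra); lra.
  - assert (0 <= (- x) * (1 - / INR (S k))) by (apply Rmult_le_pos; lra); lra.
Qed.

Definition Hsum (m : nat) : R := sum_f_R0 (fun k => / INR (S k)) m.

Lemma sum_sub_ln_1p_cv (x : R) : -1 < x ->
  exists l : R, is_lim_seq (sum_f_R0 (fun k => x / INR (S k) - ln (1 + x / INR (S k)))) l.
Proof.
  intros Hx.
  apply sum_inv_sqr_bound_cv with (C := x ^ 2 * (1 + / (1 + x))).
  intros k; destruct (div_S_bounds x k Hx) as [H1 H2].
  pose proof (ln_1p_bounds _ H1) as H3; pose proof (inv_min_1 _ _ Hx H2) as H4.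
  rewrite Rabs_pos_eq by lra.
  apply Rle_trans with ((x / INR (S k)) ^ 2 / (1 + x / INR (S k))); [lra|].
  replace (x ^ 2 * (1 + / (1 + x)) / INR (S k) ^ 2)
    with ((x / INR (S k)) ^ 2 * (1 + / (1 + x))).
  2:{ pose proof (INR_S_pos k); field; split; lra. }
  apply Rmult_le_compat_l; [apply pow2_ge_0|exact H4].
Qed.

Lemma euler_gamma_cv : is_lim_seq (fun m => Hsum m - ln (INR (S m))) euler_gamma.
Proof.
  (* At x = 1 the sum telescopes to [Hsum m - ln (INR (S (S m)))]; the index is off by one, and the
     correction [ln (1 + / INR (S m))] tends to 0. *)
  destruct (sum_sub_ln_1p_cv 1 ltac:(lra)) as [l Hl].
  assert (L : is_lim_seq (fun m => Hsum m - ln (INR (S m))) l).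
  2:{ replace euler_gamma with l; [exact L|symmetry; apply (lim_seq_eq _ l L)]. }
  replace l with (l + ln (1 + 0)) by (rewrite Rplus_0_r, ln_1; ring).
  apply (is_lim_seq_ext (fun m =>
    sum_f_R0 (fun k => 1 / INR (S k) - ln (1 + 1 / INR (S k))) m + ln (1 + / INR (S m)))).
  - intros m.
    assert (E : forall j, ln (1 + / INR (S j)) = ln (INR (S (S j))) - ln (INR (S j))).
    { intros j; rewrite (S_INR (S j)); pose proof (INR_S_pos j).
      rewrite <- ln_div by lra; f_equal; field; lra. }
    assert (sum_f_R0 (fun k => 1 / INR (S k) - ln (1 + 1 / INR (S k))) m
            = Hsum m - ln (INR (S (S m)))).
    { unfold Hsum; induction m as [|m IH].
      - change (1 / INR 1 - ln (1 + 1 / INR 1) = / INR 1 - ln (INR 2)).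
        replace (1 / INR 1) with (/ INR 1) by (unfold Rdiv; ring).
        rewrite (E 0%nat); change (INR 1) with 1; rewrite ln_1; ring.
      - rewrite !tech5, IH; replace (1 / INR (S (S m))) with (/ INR (S (S m))).
        + rewrite (E (S m)); ring.
        + pose proof (INR_S_pos (S m)); field; lra. }
    rewrite H, E; ring.
  - apply is_lim_seq_plus'; [exact Hl|].
    apply (is_lim_seq_continuous (fun v => ln (1 + v)) (fun m => / INR (S m))).
    + apply continuity_pt_filterlim, (ex_derive_continuous (fun v => ln (1 + v))).
      auto_derive; lra.
    + apply is_lim_seq_inv_S.
Qed.

(* Logarithm of the m-th term of the sequence defining [Gamma]. *)
Definition lnGam (x : R) (m : nat) : R :=
  - x * (Hsum m - ln (INR (S m)))
  + sum_f_R0 (fun k => x / INR (S k) - ln (1 + x / INR (S k))) m - ln x.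

Definition Gseq (x : R) (m : nat) : R :=
  INR (fact (S m)) * Rpower (INR (S m)) x / prod_f_R0 (fun k => x + INR k) (S m).

Lemma prod_f_R0_S (f : nat -> R) (m : nat) : prod_f_R0 f (S m) = prod_f_R0 f m * f (S m).
Proof. reflexivity. Qed.

Lemma prod_rising_pos (x : R) (m : nat) : 0 < x -> 0 < prod_f_R0 (fun k => x + INR k) m.
Proof.
  intros Hx; induction m as [|m IH]; [simpl; lra|].
  rewrite prod_f_R0_S; apply Rmult_lt_0_compat; [exact IH|].
  pose proof (pos_INR (S m)); lra.
Qed.

(** Passes from Gauss' product to Weierstrass' form: inserting x times the harmonic sum makes the
    logarithmic series converge and pairs the power (m + 1)^x with Euler's constant. *)
Lemma Gseq_exp (x : R) (m : nat) : 0 < x -> Gseq x m = exp (lnGam x m).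
Proof.
  intros Hx.
  assert (E : INR (fact (S m)) / prod_f_R0 (fun k => x + INR k) (S m)
              = exp (sum_f_R0 (fun k => x / INR (S k) - ln (1 + x / INR (S k))) m
                     - x * Hsum m - ln x)).
  { assert (step : forall j, exp (ln (1 + x / INR (S j))) = (x + INR (S j)) / INR (S j)).
    { intros j; pose proof (INR_S_pos j).
      rewrite exp_ln.
      - field; lra.
      - assert (0 < x / INR (S j)) by (apply Rdiv_lt_0_compat; lra); lra. }
    unfold Hsum; induction m as [|m IH].
    - change (INR (fact 1) / ((x + INR 0) * (x + INR 1))
        = exp (x / INR 1 - ln (1 + x / INR 1) - x * / INR 1 - ln x)).
      replace (x / INR 1 - ln (1 + x / INR 1) - x * / INR 1 - ln x)
        with (- ln (1 + x / INR 1) + - ln x) by (unfold Rdiv; ring).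
      rewrite exp_plus, !exp_Ropp, step, exp_ln by exact Hx; simpl; field; lra.
    - rewrite prod_f_R0_S, !tech5, fact_simpl, mult_INR.
      replace (sum_f_R0 (fun k => x / INR (S k) - ln (1 + x / INR (S k))) m
               + (x / INR (S (S m)) - ln (1 + x / INR (S (S m))))
               - x * (sum_f_R0 (fun k => / INR (S k)) m + / INR (S (S m))) - ln x)
        with (sum_f_R0 (fun k => x / INR (S k) - ln (1 + x / INR (S k))) m
              - x * sum_f_R0 (fun k => / INR (S k)) m - ln x + - ln (1 + x / INR (S (S m))))
        by (unfold Rdiv; ring).
      rewrite exp_plus, <- IH, exp_Ropp, step.
      pose proof (prod_rising_pos x (S m) Hx); pose proof (INR_S_pos (S m)).
      field; lra. }
  unfold Gseq, lnGam.
  replace (INR (fact (S m)) * Rpower (INR (S m)) x / prod_f_R0 (fun k => x + INR k) (S m))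
    with (INR (fact (S m)) / prod_f_R0 (fun k => x + INR k) (S m) * Rpower (INR (S m)) x)
    by (unfold Rdiv; ring).
  rewrite E; unfold Rpower; rewrite <- exp_plus; f_equal; ring.
Qed.

Lemma lnGam_cv (x : R) : 0 < x -> exists l : R, is_lim_seq (lnGam x) l /\ Gamma x = exp l.
Proof.
  intros Hx; destruct (sum_sub_ln_1p_cv x ltac:(lra)) as [l Hl].
  exists (- x * euler_gamma + l - ln x).
  assert (L : is_lim_seq (lnGam x) (- x * euler_gamma + l - ln x)).
  { apply is_lim_seq_minus'; [|apply is_lim_seq_const].
    apply is_lim_seq_plus'; [|exact Hl].
    apply (is_lim_seq_scal_l _ (- x) euler_gamma), euler_gamma_cv. }
  split; [exact L|].
  apply lim_seq_eq.
  apply (is_lim_seq_ext (fun m => exp (lnGam x m))); [|now apply is_lim_seq_exp].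
  intros m; symmetry; apply (Gseq_exp x m Hx).
Qed.

Lemma Gamma_pos (x : R) : 0 < x -> 0 < Gamma x.
Proof. intros Hx; destruct (lnGam_cv x Hx) as (l & _ & ->); apply exp_pos. Qed.

Lemma Gamma_cv (x : R) : 0 < x -> is_lim_seq (Gseq x) (Gamma x).
Proof.
  intros Hx; destruct (lnGam_cv x Hx) as (l & L & ->).
  apply (is_lim_seq_ext (fun m => exp (lnGam x m))); [|now apply is_lim_seq_exp].
  intros m; symmetry; apply (Gseq_exp x m Hx).
Qed.

Lemma is_lim_seq_shift_div (c d : R) : 0 < d ->
  is_lim_seq (fun m => (INR (S m) + c) / (INR (S m) + d)) 1.
Proof.
  intros Hd.
  replace (Finite 1) with (Finite ((1 + c * 0) / (1 + d * 0))) by (f_equal; field).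
  apply (is_lim_seq_ext (fun m => (1 + c * / INR (S m)) / (1 + d * / INR (S m)))).
  - intros m; pose proof (INR_S_pos m); field; lra.
  - apply is_lim_seq_div'; [| |lra].
    + apply is_lim_seq_plus'; [apply is_lim_seq_const|].
      apply (is_lim_seq_scal_l _ c 0), is_lim_seq_inv_S.
    + apply is_lim_seq_plus'; [apply is_lim_seq_const|].
      apply (is_lim_seq_scal_l _ d 0), is_lim_seq_inv_S.
Qed.

Lemma prod_rising_shift (x : R) (m : nat) :
  x * prod_f_R0 (fun k => x + 1 + INR k) m
  = prod_f_R0 (fun k => x + INR k) m * (x + 1 + INR m).
Proof.
  induction m as [|m IH]; [simpl; ring|].
  rewrite !prod_f_R0_S, <- Rmult_assoc, IH, S_INR; ring.
Qed.

Lemma Gamma_succ (x : R) : 0 < x -> Gamma (x + 1) = x * Gamma x.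
Proof.
  intros Hx.
  apply (is_lim_seq_eq (Gseq (x + 1))); [apply Gamma_cv; lra|].
  apply (is_lim_seq_ext (fun m => x * Gseq x m * ((INR (S m) + 0) / (INR (S m) + (x + 1))))).
  - intros m; unfold Gseq.
    pose proof (prod_rising_shift x (S m)) as E.
    pose proof (prod_rising_pos x (S m) Hx).
    pose proof (prod_rising_pos (x + 1) (S m) ltac:(lra)).
    pose proof (INR_S_pos m).
    rewrite Rpower_plus, Rpower_1 by lra.
    replace (prod_f_R0 (fun k => x + 1 + INR k) (S m))
      with (prod_f_R0 (fun k => x + INR k) (S m) * (x + 1 + INR (S m)) / x)
      by (rewrite <- E; field; lra).
    field; repeat split; lra.
  - replace (x * Gamma x) with (x * Gamma x * 1) by ring.
    apply is_lim_seq_mult'; [|apply is_lim_seq_shift_div; lra].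
    apply (is_lim_seq_scal_l _ x (Gamma x)), Gamma_cv, Hx.
Qed.

Lemma Gamma_1 : Gamma 1 = 1.
Proof.
  apply lim_seq_eq.
  apply (is_lim_seq_ext (fun m => (INR (S m) + 0) / (INR (S m) + 1)));
    [|apply is_lim_seq_shift_div; lra].
  intros m.
  assert (E : forall j, prod_f_R0 (fun k => 1 + INR k) j = INR (fact (S j))).
  { induction j as [|j IH]; [simpl; ring|].
    rewrite prod_f_R0_S, IH, (fact_simpl (S j)), mult_INR, (S_INR (S j)); ring. }
  rewrite E, Rpower_1, (fact_simpl (S m)), mult_INR, (S_INR (S m)) by apply INR_S_pos.
  pose proof (INR_S_pos m); pose proof (INR_fact_lt_0 (S m)); field; lra.
Qed.

(** Even factors are 2 (z + k) and odd factors are 2 (z + 1/2 + k). *)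
Lemma prod_rising_double (z : R) (m : nat) :
  prod_f_R0 (fun k => 2 * z + INR k) (2 * m + 1)
  = 4 ^ (S m) * prod_f_R0 (fun k => z + INR k) m * prod_f_R0 (fun k => z + /2 + INR k) m.
Proof.
  induction m as [|m IH].
  - simpl; field.
  - replace (2 * S m + 1)%nat with (S (S (2 * m + 1))) by lia.
    rewrite !prod_f_R0_S, IH, !S_INR, plus_INR, mult_INR; simpl; field.
Qed.

(* Legendre has c = 2 * sqrt PI; the value cancels in the end. *)
Lemma Gamma_duplication :
  exists c : R, 0 < c /\ forall z, 0 < z ->
    Gamma z * Gamma (z + /2) = c * Rpower 2 (- (2 * z)) * Gamma (2 * z).
Proof.
  (* What remains of the Gauss terms once every z has cancelled. Its limit is therefore the same for
     all z, and z = 1 supplies the constant. *)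
  set (A := fun m => INR (fact (S m)) ^ 2 * Rpower (INR (S m)) (/2) * 4 ^ (S (S m))
                     / INR (fact (S (2 * m + 2)))).
  assert (L : forall z, 0 < z ->
    is_lim_seq A (Gamma z * Gamma (z + /2) / Gamma (2 * z) * Rpower 2 (2 * z))).
  { intros z Hz.
    (* Index [2 * m + 2] gives the denominator 2 (m + 2) factors, as many as the two numerators
       together. The last power trades (2 m + 3)^(2 z) for (m + 1)^(2 z) and tends to 2^(2 z). *)
    apply (is_lim_seq_ext (fun m => Gseq z m * Gseq (z + /2) m / Gseq (2 * z) (2 * m + 2)
             * Rpower ((2 * INR (S m) + 1) / INR (S m)) (2 * z))).
    - intros m; unfold A, Gseq.
      pose proof (prod_rising_double z (S m)) as E.
      replace (2 * S m + 1)%nat with (S (2 * m + 2)) in E by lia.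
      pose proof (prod_rising_pos z (S m) Hz).
      pose proof (prod_rising_pos (z + /2) (S m) ltac:(lra)).
      pose proof (INR_S_pos m); pose proof (INR_fact_lt_0 (S (2 * m + 2))).
      assert (E2 : INR (S (2 * m + 2)) = 2 * INR (S m) + 1)
        by (rewrite !S_INR, plus_INR, mult_INR; simpl; ring).
      rewrite E, E2.
      unfold Rdiv at 5; rewrite <- Rpower_mult_distr by
        (try apply Rinv_0_lt_compat; lra).
      replace (Rpower (/ INR (S m)) (2 * z)) with (/ (Rpower (INR (S m)) z * Rpower (INR (S m)) z)).
      2:{ rewrite <- Rpower_plus, <- Rpower_Ropp.
          unfold Rpower; f_equal; rewrite ln_Rinv by lra; ring. }
      rewrite Rpower_plus.
      assert (0 < Rpower (INR (S m)) z) by apply exp_pos.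
      assert (0 < Rpower (2 * INR (S m) + 1) (2 * z)) by apply exp_pos.
      field; repeat split; try lra; apply pow_nonzero; lra.
    - apply is_lim_seq_mult'.
      + apply is_lim_seq_div'; [| |apply Rgt_not_eq, Gamma_pos; lra].
        * apply is_lim_seq_mult'; apply Gamma_cv; lra.
        * apply (is_lim_seq_subseq (Gseq (2 * z)) _ (fun m => (2 * m + 2)%nat));
            [|apply Gamma_cv; lra].
          apply eventually_subseq; intros; lia.
      + apply (is_lim_seq_continuous (fun v => Rpower v (2 * z))
                 (fun m => (2 * INR (S m) + 1) / INR (S m)) 2).
        * apply continuity_pt_filterlim, (ex_derive_continuous (fun v => Rpower v (2 * z))).
          unfold Rpower; auto_derive; lra.
        * replace (Finite 2) with (Finite (2 + 0)) by (f_equal; ring).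
          apply (is_lim_seq_ext (fun m => 2 + / INR (S m))).
          -- intros m; pose proof (INR_S_pos m); field; lra.
          -- apply is_lim_seq_plus'; [apply is_lim_seq_const|apply is_lim_seq_inv_S]. }
  exists (Gamma 1 * Gamma (1 + /2) / Gamma (2 * 1) * Rpower 2 (2 * 1)); split.
  - apply Rmult_lt_0_compat; [|apply exp_pos].
    apply Rdiv_lt_0_compat; [apply Rmult_lt_0_compat|]; apply Gamma_pos; lra.
  - intros z Hz.
    rewrite (is_lim_seq_eq _ _ _ (L 1 ltac:(lra)) (L z Hz)).
    rewrite Rpower_Ropp.
    assert (0 < Rpower 2 (2 * z)) by apply exp_pos.
    pose proof (Gamma_pos (2 * z) ltac:(lra)); field; lra.
Qed.

(** * The Barnes G-function *)

(* Logarithm of the partial products in the definition of [BarnesG], with x = y - 1. *)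
Definition lnBarnes (x : R) (m : nat) : R :=
  sum_f_R0 (fun k => INR (S k) * ln (1 + x / INR (S k)) - x + x ^ 2 / (2 * INR (S k))) m.

(** With u = x / (k + 1), each summand is (k + 1) times the cubic remainder of ln (1 + u), hence of
    order 1/k^2. *)
Lemma lnBarnes_cv (x : R) : -1 < x -> exists l : R, is_lim_seq (lnBarnes x) l /\
  BarnesG (x + 1) =
    Rpower (2 * PI) (x / 2) * exp (- (x * (x + 1) + euler_gamma * x ^ 2) / 2) * exp l.
Proof.
  intros Hx.
  destruct (sum_inv_sqr_bound_cv
    (fun k => INR (S k) * ln (1 + x / INR (S k)) - x + x ^ 2 / (2 * INR (S k)))
    (Rabs x ^ 3 * (2 + / (1 + x)))) as [l Hl].
  { intros k; destruct (div_S_bounds x k Hx) as [H1 H2].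
    pose proof (ln_1p_taylor2 _ H1) as H3; pose proof (inv_min_1 _ _ Hx H2) as H4.
    pose proof (INR_S_pos k) as Hk.
    set (u := x / INR (S k)) in *.
    replace (INR (S k) * ln (1 + u) - x + x ^ 2 / (2 * INR (S k)))
      with (INR (S k) * (ln (1 + u) - u + u ^ 2 / 2)) by (unfold u; field; lra).
    rewrite Rabs_mult, (Rabs_pos_eq (INR (S k))) by lra.
    replace (Rabs x ^ 3 * (2 + / (1 + x)) / INR (S k) ^ 2)
      with (INR (S k) * (Rabs u ^ 3 * (2 + / (1 + x)))).
    2:{ unfold u, Rdiv; rewrite Rabs_mult, Rabs_inv, (Rabs_pos_eq (INR (S k))) by lra.
        field; split; lra. }
    apply Rmult_le_compat_l; [lra|].
    eapply Rle_trans; [exact H3|].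
    apply Rmult_le_compat_l; [apply pow_le, Rabs_pos|lra]. }
  exists l; split; [exact Hl|].
  unfold BarnesG; cbv zeta; replace (x + 1 - 1) with x by ring.
  f_equal; apply lim_seq_eq.
  apply (is_lim_seq_ext (fun m => exp (lnBarnes x m))); [|now apply is_lim_seq_exp].
  assert (F : forall k,
    exp (INR (S k) * ln (1 + x / INR (S k)) - x + x ^ 2 / (2 * INR (S k)))
    = (1 + x / INR (S k)) ^ (S k) * exp (- x + x ^ 2 / (2 * INR (S k)))).
  { intros k; destruct (div_S_bounds x k Hx).
    rewrite <- (Rpower_pow (S k) (1 + x / INR (S k))) by lra.
    unfold Rpower; rewrite <- exp_plus; f_equal; ring. }
  intros m; unfold lnBarnes; induction m as [|m IH]; [apply (F 0%nat)|].
  rewrite tech5, exp_plus, IH, prod_f_R0_S, F; reflexivity.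
Qed.

Lemma BarnesG_pos (y : R) : 0 < y -> 0 < BarnesG y.
Proof.
  intros Hy; destruct (lnBarnes_cv (y - 1) ltac:(lra)) as (l & _ & E).
  replace (y - 1 + 1) with y in E by ring; rewrite E.
  repeat apply Rmult_lt_0_compat; apply exp_pos.
Qed.

(** Supplies the limit of the first term on the right of [lnBarnes_shift]. *)
Lemma is_lim_seq_mul_ln_1p (x : R) : -1 < x ->
  is_lim_seq (fun m => (INR (S m) + 1) * ln (1 + x / INR (S m))) x.
Proof.
  intros Hx.
  assert (L0 : is_lim_seq (fun m => x * / INR (S m)) (x * 0))
    by apply (is_lim_seq_scal_l _ x 0), is_lim_seq_inv_S.
  assert (L1 : is_lim_seq (fun m => INR (S m) * ln (1 + x / INR (S m))) x).
  { apply (is_lim_seq_le_le (fun m => x - x ^ 2 * (1 + / (1 + x)) * / INR (S m)) _ (fun _ => x)).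
    - intros m; destruct (div_S_bounds x m Hx) as [H1 H2].
      pose proof (ln_1p_bounds _ H1) as [H3 H4]; pose proof (inv_min_1 _ _ Hx H2) as H5.
      pose proof (INR_S_pos m) as Hm.
      split.
      + apply Rle_trans with (INR (S m) * (x / INR (S m) - (x / INR (S m)) ^ 2 / (1 + x / INR (S m)))).
        * replace (INR (S m) * (x / INR (S m) - (x / INR (S m)) ^ 2 / (1 + x / INR (S m))))
            with (x - x ^ 2 * / INR (S m) * / (1 + x / INR (S m))).
          2:{ assert (0 < x + INR (S m)).
              { replace (x + INR (S m)) with (INR (S m) * (1 + x / INR (S m))) by (field; lra).
                apply Rmult_lt_0_compat; lra. }
              field; split; lra. }
          assert (0 <= x ^ 2 * / INR (S m) * (1 + / (1 + x) - / (1 + x / INR (S m)))); [|lra].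
          apply Rmult_le_pos; [apply Rmult_le_pos|lra].
          -- apply pow2_ge_0.
          -- left; now apply Rinv_0_lt_compat.
        * apply Rmult_le_compat_l; lra.
      + apply Rle_trans with (INR (S m) * (x / INR (S m))).
        * apply Rmult_le_compat_l; lra.
        * right; field; lra.
    - replace (Finite x) with (Finite (x - x ^ 2 * (1 + / (1 + x)) * 0)) by (f_equal; ring).
      apply is_lim_seq_minus'; [apply is_lim_seq_const|].
      apply (is_lim_seq_scal_l _ _ 0), is_lim_seq_inv_S.
    - apply is_lim_seq_const. }
  replace (Finite x) with (Finite (x + ln (1 + x * 0))).
  2:{ rewrite Rmult_0_r, Rplus_0_r, ln_1; f_equal; ring. }
  apply (is_lim_seq_ext (fun m => INR (S m) * ln (1 + x / INR (S m)) + ln (1 + x * / INR (S m)))).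
  - intros m; unfold Rdiv; ring.
  - apply is_lim_seq_plus'; [exact L1|].
    apply (is_lim_seq_continuous (fun v => ln (1 + v)) (fun m => x * / INR (S m)) (x * 0));
      [|exact L0].
    apply continuity_pt_filterlim, (ex_derive_continuous (fun v => ln (1 + v))).
    auto_derive; lra.
Qed.

(* The last summand, Stirling's sequence, does not depend on x. *)
Lemma lnBarnes_shift (x : R) (m : nat) : 0 < x ->
  lnBarnes x m - lnBarnes (x - 1) m - lnGam x m
  = (INR (S m) + 1) * ln (1 + x / INR (S m)) + (x - /2) * (Hsum m - ln (INR (S m)))
    + ((INR (S m) + /2) * ln (INR (S m)) - INR (S m)
       - sum_f_R0 (fun k => ln (INR (S k))) m).
Proof.
  intros Hx.
  assert (E : forall y j, - INR (S j) < y -> ln (1 + y / INR (S j)) = ln (INR (S j) + y) - ln (INR (S j))).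
  { intros y j Hy; pose proof (INR_S_pos j).
    rewrite <- ln_div by lra; f_equal; field; lra. }
  assert (P : forall j, 1 <= INR (S j)) by (intros j; rewrite S_INR; pose proof (pos_INR j); lra).
  unfold lnBarnes, lnGam, Hsum; induction m as [|m IH].
  - unfold sum_f_R0; rewrite !E by (change (INR 1) with 1; lra); change (INR 1) with 1.
    rewrite ln_1; replace (1 + (x - 1)) with x by ring; field.
  - rewrite !tech5.
    pose proof (P m); pose proof (P (S m)).
    rewrite !E in * by lra; rewrite (S_INR (S m)) in *; set (M := INR (S m)) in *.
    replace (M + 1 + (x - 1)) with (M + x) in * by ring.
    revert IH.
    generalize (sum_f_R0 (fun k => INR (S k) * ln (1 + x / INR (S k)) - x
                                   + x ^ 2 / (2 * INR (S k))) m).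
    generalize (sum_f_R0 (fun k => INR (S k) * ln (1 + (x - 1) / INR (S k)) - (x - 1)
                                   + (x - 1) ^ 2 / (2 * INR (S k))) m).
    generalize (sum_f_R0 (fun k => / INR (S k)) m)
      (sum_f_R0 (fun k => x / INR (S k) - ln (1 + x / INR (S k))) m)
      (sum_f_R0 (fun k => ln (INR (S k))) m).
    intros s1 s2 s3 s4 s5 IH.
    assert (s5 = s4 + (- x * (s1 - ln M) + s2 - ln x)
                 + ((M + 1) * (ln (M + x) - ln M) + (x - / 2) * (s1 - ln M)
                    + ((M + / 2) * ln M - M - s3))) as -> by lra.
    field; lra.
Qed.

(* Here kappa = 1 by Stirling's formula, but only its existence matters:
   it cancels in the quotients of [BarnesG] values considered below. *)
Lemma BarnesG_succ :
  exists kappa : R, 0 < kappa /\ forall x, 0 < x -> BarnesG (x + 1) = kappa * Gamma x * BarnesG x.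
Proof.
  set (A := fun m => (INR (S m) + /2) * ln (INR (S m)) - INR (S m)
                     - sum_f_R0 (fun k => ln (INR (S k))) m).
  assert (L : forall x, 0 < x -> exists l : R, is_lim_seq A l /\
    BarnesG (x + 1) = Rpower (2 * PI) (/2) * exp l * Gamma x * BarnesG x).
  { intros x Hx.
    destruct (lnBarnes_cv x ltac:(lra)) as (l1 & L1 & ->).
    destruct (lnBarnes_cv (x - 1) ltac:(lra)) as (l2 & L2 & E2).
    replace (x - 1 + 1) with x in E2 by ring; rewrite E2.
    destruct (lnGam_cv x Hx) as (l3 & L3 & ->).
    (* This is [lnBarnes_shift] solved for [A] in the limit. The last two terms are also the change
       in the exponential prefactor from [BarnesG x] to [BarnesG (x + 1)], so only (2 pi)^(1/2) and
       the limit of [A] survive. *)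
    exists (l1 - l2 - l3 - x - (x - /2) * euler_gamma); split.
    - apply (is_lim_seq_ext (fun m => lnBarnes x m - lnBarnes (x - 1) m - lnGam x m
        - (INR (S m) + 1) * ln (1 + x / INR (S m)) - (x - /2) * (Hsum m - ln (INR (S m))))).
      + intros m; rewrite lnBarnes_shift by exact Hx; unfold A; ring.
      + repeat apply is_lim_seq_minus'; try assumption.
        * apply is_lim_seq_mul_ln_1p; lra.
        * apply (is_lim_seq_scal_l _ _ euler_gamma), euler_gamma_cv.
    - unfold Rpower; rewrite <- !exp_plus; f_equal; field. }
  destruct (L 1 ltac:(lra)) as (l & Hl & _).
  exists (Rpower (2 * PI) (/2) * exp l); split.
  - apply Rmult_lt_0_compat; apply exp_pos.
  - intros x Hx; destruct (L x Hx) as (l' & Hl' & ->).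
    now rewrite (is_lim_seq_eq _ _ _ Hl Hl').
Qed.

(** * The Beta integral *)

(* [ring] does not see through the canonical structures of Coquelicot. *)
Ltac real_eq := match goal with |- ?a = ?b => change (@eq R a b) end.

Lemma powr_pos_eq (x a : R) : 0 < x -> powr x a = Rpower x a.
Proof. intros Hx; unfold powr; destruct (Rle_dec x 0); [lra|reflexivity]. Qed.

Lemma powr_nonpos (x a : R) : x <= 0 -> powr x a = 0.
Proof. intros Hx; unfold powr; destruct (Rle_dec x 0); [reflexivity|lra]. Qed.

Lemma powr_ge_0 (x a : R) : 0 <= powr x a.
Proof.
  destruct (Rle_lt_dec x 0); [rewrite powr_nonpos by lra; lra|].
  rewrite powr_pos_eq by lra; left; apply exp_pos.
Qed.

Lemma powr_succ (x a : R) : powr x (a + 1) = x * powr x a.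
Proof.
  destruct (Rle_lt_dec x 0).
  - rewrite !powr_nonpos by lra; ring.
  - rewrite !powr_pos_eq, Rpower_plus, Rpower_1 by lra; ring.
Qed.

Lemma powr_mult (x y a : R) : 0 < x -> powr (x * y) a = Rpower x a * powr y a.
Proof.
  intros Hx; destruct (Rle_lt_dec y 0).
  - rewrite (powr_nonpos y) by lra; rewrite powr_nonpos; [ring|].
    assert (0 <= x * (- y)) by (apply Rmult_le_pos; lra); lra.
  - rewrite !powr_pos_eq; [rewrite Rpower_mult_distr; auto|lra|].
    now apply Rmult_lt_0_compat.
Qed.

(** The modulus eps^(1/a) gives both the continuity of [powr] at 0 and the derivative of
    [powr y (a + 1)] there, whose difference quotient is [powr h a] for h of either sign. *)
Lemma powr_small (a eps : R) : 0 < a -> 0 < eps ->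
  forall h, Rabs h < Rpower eps (/ a) -> Rabs (powr h a) < eps.
Proof.
  intros Ha He h Hh; rewrite Rabs_pos_eq by apply powr_ge_0.
  destruct (Rle_lt_dec h 0); [rewrite powr_nonpos; lra|].
  rewrite powr_pos_eq by lra; rewrite Rabs_pos_eq in Hh by lra.
  replace eps with (Rpower (Rpower eps (/ a)) a).
  - unfold Rpower at 1 2; apply exp_increasing, Rmult_lt_compat_l; [exact Ha|].
    now apply ln_increasing.
  - rewrite Rpower_mult, Rinv_l, Rpower_1 by lra; reflexivity.
Qed.

Lemma is_derive_powr (x a : R) : 0 < a ->
  is_derive (fun y => powr y (a + 1)) x ((a + 1) * powr x a).
Proof.
  intros Ha; destruct (total_order_T x 0) as [[Hx|Hx]|Hx].
  - rewrite powr_nonpos by lra; rewrite Rmult_0_r.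
    apply (is_derive_ext_loc (fun _ => 0)); [|exact (is_derive_const (K := R_AbsRing) (V := R_NormedModule) 0 x)].
    apply (filter_imp (fun y => y < 0)); [|apply open_lt; lra].
    intros y Hy; rewrite powr_nonpos; lra.
  - subst x; apply is_derive_Reals; intros eps Heps.
    exists (mkposreal (Rpower eps (/ a)) (exp_pos _)); simpl; intros h Hh Hd.
    rewrite Rplus_0_l, !(powr_nonpos 0), powr_succ by lra.
    replace ((h * powr h a - 0) / h - (a + 1) * 0) with (powr h a) by (field; exact Hh).
    now apply powr_small.
  - rewrite powr_pos_eq by lra.
    apply (is_derive_ext_loc (fun y => Rpower y (a + 1))).
    + apply (filter_imp (fun y => 0 < y)); [|apply open_gt; lra].
      intros y Hy; rewrite powr_pos_eq; lra.
    + apply is_derive_Reals; replace a with (a + 1 - 1) at 2 by ring.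
      now apply derivable_pt_lim_power.
Qed.

Lemma continuous_powr (x a : R) : 0 < a -> continuous (fun y => powr y a) x.
Proof.
  intros Ha.
  destruct (total_order_T x 0) as [[Hx|Hx]|Hx].
  - apply (continuous_ext_loc _ (fun _ => 0)); [|apply continuous_const].
    apply (filter_imp (fun y => y < 0)); [|apply open_lt; lra].
    intros y Hy; rewrite powr_nonpos; [reflexivity|lra].
  - subst x; apply continuity_pt_filterlim; intros eps Heps.
    exists (Rpower eps (/ a)); split; [apply exp_pos|].
    intros y [_ Hy]; simpl in *; unfold R_dist in *.
    rewrite (powr_nonpos 0), Rminus_0_r in * by lra; now apply powr_small.
  - apply (continuous_ext_loc _ (fun y => Rpower y a)).
    + apply (filter_imp (fun y => 0 < y)); [|apply open_gt; lra].
      intros y Hy; rewrite powr_pos_eq; auto.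
    + apply (ex_derive_continuous (fun y => Rpower y a)).
      unfold Rpower; auto_derive; lra.
Qed.

Lemma continuous_powr_1m (x b : R) : 0 < b -> continuous (fun y => powr (1 - y) b) x.
Proof.
  intros Hb; apply (continuous_comp (fun y => 1 - y) (fun z => powr z b)).
  - apply (ex_derive_continuous (fun y => 1 - y)); auto_derive; auto.
  - now apply continuous_powr.
Qed.

Lemma is_derive_powr_1m (x b : R) : 0 < b ->
  is_derive (fun y => powr (1 - y) (b + 1)) x (- (b + 1) * powr (1 - x) b).
Proof.
  intros Hb.
  replace (- (b + 1) * powr (1 - x) b) with (scal (-1) ((b + 1) * powr (1 - x) b))
    by (unfold scal; simpl; unfold mult; simpl; ring).
  apply (is_derive_comp (fun z => powr z (b + 1)) (fun y => 1 - y)).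
  - now apply is_derive_powr.
  - auto_derive; auto; ring.
Qed.

(** The integrand is the derivative of u(x) (1 - x)^(b+1), which vanishes at 1. Leaving u general
    covers a = 0 through u = 1 and u = x, where powers with exponent a would be discontinuous at
    0. *)
Lemma RInt_parts_powr_1m (u u' : R -> R) (b : R) : 0 < b ->
  (forall x, is_derive u x (u' x)) -> (forall x, continuous u' x) ->
  is_RInt (fun x => u' x * powr (1 - x) (b + 1) - (b + 1) * (u x * powr (1 - x) b)) 0 1 (- u 0).
Proof.
  intros Hb Hu Hu'.
  assert (E : - u 0 = minus (u 1 * powr (1 - 1) (b + 1)) (u 0 * powr (1 - 0) (b + 1))).
  { rewrite (powr_nonpos (1 - 1)), powr_pos_eq, Rminus_0_r by lra.
    unfold Rpower; rewrite ln_1, (Rmult_0_r (b + 1)), exp_0.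
    unfold minus, plus, opp; simpl; ring. }
  rewrite E.
  apply (is_RInt_derive (fun x => u x * powr (1 - x) (b + 1))).
  - intros x _.
    replace (u' x * powr (1 - x) (b + 1) - (b + 1) * (u x * powr (1 - x) b))
      with (plus (mult (u' x) (powr (1 - x) (b + 1))) (mult (u x) (- (b + 1) * powr (1 - x) b)))
      by (unfold plus, mult; simpl; ring).
    apply (is_derive_mult u (fun x => powr (1 - x) (b + 1))).
    + apply Hu.
    + now apply is_derive_powr_1m.
    + apply Rmult_comm.
  - intros x _.
    apply (continuous_minus (fun x => u' x * powr (1 - x) (b + 1))
             (fun x => (b + 1) * (u x * powr (1 - x) b))).
    + apply (continuous_mult u'); [apply Hu'|apply continuous_powr_1m; lra].
    + apply (continuous_mult (fun _ => b + 1) (fun x => u x * powr (1 - x) b));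
        [apply continuous_const|].
      apply (continuous_mult u); [|now apply continuous_powr_1m].
      apply (ex_derive_continuous u); now exists (u' x).
Qed.

(** Euler's B(a + 1, b + 1), indexed by the exponents of the Jacobi weight. *)
Definition bint (a b : R) : R := RInt (fun x => powr x a * powr (1 - x) b) 0 1.

Lemma ex_RInt_continuous_01 (f : R -> R) : (forall x, continuous f x) -> ex_RInt f 0 1.
Proof. intros H; apply (ex_RInt_continuous (V := R_CompleteNormedModule)); intros; apply H. Qed.

(* [powr] vanishes at 0 even for a = 0, so the integrand is continuous only on ]0, 1]. *)
Lemma ex_bint (a b : R) : 0 <= a -> 0 < b ->
  ex_RInt (fun x => powr x a * powr (1 - x) b) 0 1.
Proof.
  intros [Ha|Ha] Hb.
  - apply ex_RInt_continuous_01; intros x.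
    apply (continuous_mult (fun x => powr x a));
      [now apply continuous_powr|now apply continuous_powr_1m].
  - apply (ex_RInt_ext (fun x => powr (1 - x) b)).
    + intros x; rewrite Rmin_left, Rmax_right by lra; intros Hx.
      rewrite (powr_pos_eq x), <- Ha, Rpower_O by lra; real_eq; ring.
    + apply ex_RInt_continuous_01; intros; now apply continuous_powr_1m.
Qed.

Lemma bint_ext (f : R -> R) (a b : R) :
  (forall x, 0 < x < 1 -> f x = powr x a * powr (1 - x) b) -> RInt f 0 1 = bint a b.
Proof.
  intros H; apply RInt_ext; intros x; rewrite Rmin_left, Rmax_right by lra; apply H.
Qed.

Lemma bint_0 (b : R) : 0 < b -> bint 0 b = / (b + 1).
Proof.
  intros Hb.
  pose proof (RInt_parts_powr_1m (fun _ => 1) (fun _ => 0) b Hb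
    (fun x => is_derive_const (K := R_AbsRing) (V := R_NormedModule) 1 x)
    (fun x => continuous_const 0 x)) as H.
  apply (is_RInt_unique (V := R_CompleteNormedModule)) in H; cbv beta in H.
  rewrite (RInt_ext _ (fun x => - (b + 1) * (powr x 0 * powr (1 - x) b))) in H.
  2:{ intros x; rewrite Rmin_left, Rmax_right by lra; intros Hx.
      rewrite (powr_pos_eq x), Rpower_O by lra; real_eq; ring. }
  rewrite (RInt_scal (V := R_CompleteNormedModule) (fun x => powr x 0 * powr (1 - x) b)) in H
    by (apply ex_bint; lra).
  change (- (b + 1) * bint 0 b = - 1) in H.
  apply (Rmult_eq_reg_l (b + 1)); [|lra].
  rewrite Rinv_r by lra; lra.
Qed.

Lemma bint_succ_r (a b : R) : 0 <= a -> 0 < b -> bint a (b + 1) = bint a b - bint (a + 1) b.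
Proof.
  intros Ha Hb; unfold bint.
  rewrite <- (RInt_minus (V := R_CompleteNormedModule) (fun x => powr x a * powr (1 - x) b)
    (fun x => powr x (a + 1) * powr (1 - x) b)) by (apply ex_bint; lra).
  apply RInt_ext; intros x _; unfold minus, plus, opp; simpl; rewrite !powr_succ; real_eq; ring.
Qed.

(** The function x^(a+1) (1-x)^(b+1) vanishes at both ends, so its derivative integrates to 0;
    [bint_succ_r] then removes the raised exponent b + 1. *)
Lemma bint_succ_l (a b : R) : 0 <= a -> 0 < b ->
  (a + b + 2) * bint (a + 1) b = (a + 1) * bint a b.
Proof.
  intros Ha Hb.
  assert (H : RInt (fun x => (a + 1) * (powr x a * powr (1 - x) (b + 1))
                    - (b + 1) * (powr x (a + 1) * powr (1 - x) b)) 0 1 = 0).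
  { destruct Ha as [Ha|Ha].
    - transitivity (- powr 0 (a + 1)); [|rewrite powr_nonpos; lra].
      apply is_RInt_unique.
      eapply is_RInt_ext; [|apply (RInt_parts_powr_1m (fun x => powr x (a + 1))
        (fun x => (a + 1) * powr x a) b Hb)].
      + intros x _; simpl; real_eq; ring.
      + intros x; now apply is_derive_powr.
      + intros x; apply (continuous_mult (fun _ => a + 1) (fun x => powr x a));
          [apply continuous_const|now apply continuous_powr].
    (* For a = 0 the identity function stands in for [powr x 1]; the two integrands agree on the
       open interval, which is enough for the integral. *)
    - subst a; apply is_RInt_unique.
      pose proof (RInt_parts_powr_1m (fun x => x) (fun _ => 1) b Hb
        (fun x => is_derive_id (K := R_AbsRing) x) (fun x => continuous_const 1 x)) as H.
      cbv beta in H; rewrite Ropp_0 in H.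
      eapply is_RInt_ext; [|exact H].
      intros x; rewrite Rmin_left, Rmax_right by lra; intros Hx; simpl.
      rewrite !powr_succ, (powr_pos_eq x), Rpower_O by lra; real_eq; ring. }
  assert (H' : (a + 1) * bint a (b + 1) - (b + 1) * bint (a + 1) b = 0).
  { rewrite <- H at 1; symmetry; apply is_RInt_unique.
    apply (is_RInt_minus (V := R_NormedModule)
      (fun x => (a + 1) * (powr x a * powr (1 - x) (b + 1)))
      (fun x => (b + 1) * (powr x (a + 1) * powr (1 - x) b))).
    - apply (is_RInt_scal (V := R_NormedModule) (fun x => powr x a * powr (1 - x) (b + 1))).
      apply (RInt_correct (V := R_CompleteNormedModule)), ex_bint; lra.
    - apply (is_RInt_scal (V := R_NormedModule) (fun x => powr x (a + 1) * powr (1 - x) b)).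
      apply (RInt_correct (V := R_CompleteNormedModule)), ex_bint; lra. }
  rewrite bint_succ_r in H' by lra; lra.
Qed.

Lemma bint_decr (a a' b : R) : 0 <= a <= a' -> 0 < b -> bint a' b <= bint a b.
Proof.
  intros Ha Hb; apply RInt_le; [lra|apply ex_bint; lra|apply ex_bint; lra|].
  intros x Hx; apply Rmult_le_compat_r; [apply powr_ge_0|].
  rewrite !powr_pos_eq by lra.
  unfold Rpower.
  assert (ln x <= 0) by (rewrite <- ln_1; left; apply ln_increasing; lra).
  destruct (Rle_lt_or_eq_dec a a' ltac:(lra)) as [L| ->]; [|lra].
  destruct (Rle_lt_or_eq_dec (a' * ln x) (a * ln x)) as [L'| ->]; [| |lra].
  - assert (0 <= (a' - a) * - ln x) by (apply Rmult_le_pos; lra); lra.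
  - left; now apply exp_increasing.
Qed.

Lemma bint_nat_pos (m : nat) (b : R) : 0 < b -> 0 < bint (INR m) b.
Proof.
  intros Hb; induction m as [|m IH].
  - simpl; rewrite bint_0 by exact Hb; apply Rinv_0_lt_compat; lra.
  - rewrite S_INR; pose proof (pos_INR m).
    apply (Rmult_lt_reg_l (INR m + b + 2)); [lra|].
    rewrite bint_succ_l, Rmult_0_r by lra; apply Rmult_lt_0_compat; lra.
Qed.

Lemma bint_shift_cv (N : nat) (b : R) : 0 < b ->
  is_lim_seq (fun m => bint (INR (S m) + INR N) b / bint (INR (S m)) b) 1.
Proof.
  intros Hb; induction N as [|N IH].
  - apply (is_lim_seq_ext (fun _ => 1)); [|apply is_lim_seq_const].
    intros m; simpl (INR 0); rewrite Rplus_0_r.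
    pose proof (bint_nat_pos (S m) b Hb); field; lra.
  - replace (Finite 1) with (Finite (1 * 1)) by (f_equal; ring).
    apply (is_lim_seq_ext (fun m => bint (INR (S m) + INR N) b / bint (INR (S m)) b
             * ((INR (S m) + (INR N + 1)) / (INR (S m) + (INR N + b + 2))))).
    + intros m; pose proof (bint_nat_pos (S m) b Hb); pose proof (pos_INR N); pose proof (INR_S_pos m).
      pose proof (bint_succ_l (INR (S m) + INR N) b ltac:(lra) Hb) as E.
      rewrite (S_INR N), <- (Rplus_assoc _ (INR N)).
      replace (bint (INR (S m) + INR N + 1) b)
        with ((INR (S m) + INR N + 1) * bint (INR (S m) + INR N) b / (INR (S m) + INR N + b + 2))
        by (rewrite <- E; field; lra).
      field; lra.
    + apply is_lim_seq_mult'; [exact IH|].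
      pose proof (pos_INR N); apply is_lim_seq_shift_div; lra.
Qed.

Lemma bint_rising (a b : R) (m : nat) : 0 <= a -> 0 < b ->
  bint a b * prod_f_R0 (fun k => a + 1 + INR k) m
  = bint (a + INR (S m)) b * prod_f_R0 (fun k => a + b + 2 + INR k) m.
Proof.
  intros Ha Hb; induction m as [|m IH].
  - simpl; pose proof (bint_succ_l a b Ha Hb); lra.
  - rewrite !prod_f_R0_S, <- Rmult_assoc, IH.
    pose proof (pos_INR (S m)).
    pose proof (bint_succ_l (a + INR (S m)) b ltac:(lra) Hb) as E.
    rewrite (S_INR (S m)), <- (Rplus_assoc a) .
    transitivity ((a + INR (S m) + 1) * bint (a + INR (S m)) b
                  * prod_f_R0 (fun k => a + b + 2 + INR k) m); [ring|].
    rewrite <- E; rewrite (S_INR m); ring.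
Qed.

(** Dividing [bint_rising] for a by the same relation for 0 expresses bint a b / bint 0 b by rising
    factorials, that is by Gauss terms, up to the factor bint (m + a) b / bint m b. That factor
    tends to 1 by monotonicity in the first exponent. *)
Theorem bint_Gamma (a b : R) : 0 <= a -> 0 < b ->
  bint a b = Gamma (a + 1) * Gamma (b + 1) / Gamma (a + b + 2).
Proof.
  intros Ha Hb.
  assert (L : is_lim_seq (fun m => bint (INR (S (S m)) + a) b / bint (INR (S (S m))) b) 1).
  { destruct (INR_unbounded a) as [N HN].
    apply (is_lim_seq_le_le
      (fun m => bint (INR (S (S m)) + INR N) b / bint (INR (S (S m))) b) _ (fun _ => 1)).
    - intros m; pose proof (bint_nat_pos (S (S m)) b Hb); pose proof (pos_INR (S (S m))).
      split; [|apply Rle_div_l; [lra|]; rewrite Rmult_1_l; apply bint_decr; lra].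
      apply Rmult_le_compat_r; [left; now apply Rinv_0_lt_compat|].
      apply bint_decr; lra.
    - apply (is_lim_seq_incr_1 (fun m => bint (INR (S m) + INR N) b / bint (INR (S m)) b)).
      now apply bint_shift_cv.
    - apply is_lim_seq_const. }
  assert (E : bint a b = bint 0 b * (1 * (Gamma (a + 1) * Gamma (b + 2) / (Gamma (a + b + 2) * Gamma 1)))).
  { symmetry; apply (is_lim_seq_eq (fun m => bint 0 b *
      (bint (INR (S (S m)) + a) b / bint (INR (S (S m))) b *
       (Gseq (a + 1) m * Gseq (b + 2) m / (Gseq (a + b + 2) m * Gseq 1 m))))).
    - apply (is_lim_seq_scal_l _ (bint 0 b) (Finite _)), is_lim_seq_mult'; [exact L|].
      apply is_lim_seq_div'.
      + apply is_lim_seq_mult'; apply Gamma_cv; lra.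
      + apply is_lim_seq_mult'; apply Gamma_cv; lra.
      + apply Rgt_not_eq, Rmult_lt_0_compat; apply Gamma_pos; lra.
    - apply (is_lim_seq_ext (fun _ => bint a b)); [|apply is_lim_seq_const].
      intros m; unfold Gseq.
      pose proof (bint_rising a b (S m) Ha Hb) as E1.
      pose proof (bint_rising 0 b (S m) ltac:(lra) Hb) as E2.
      replace (fun k => 0 + 1 + INR k) with (fun k => 1 + INR k) in E2
        by (apply FunctionalExtensionality.functional_extensionality; intros; ring).
      replace (fun k => 0 + b + 2 + INR k) with (fun k => b + 2 + INR k) in E2
        by (apply FunctionalExtensionality.functional_extensionality; intros; ring).
      rewrite Rplus_0_l in E2; rewrite (Rplus_comm _ a).
      pose proof (prod_rising_pos (a + 1) (S m) ltac:(lra)).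
      pose proof (prod_rising_pos (a + b + 2) (S m) ltac:(lra)).
      pose proof (prod_rising_pos (b + 2) (S m) ltac:(lra)).
      pose proof (prod_rising_pos 1 (S m) ltac:(lra)).
      replace (bint a b) with (bint (a + INR (S (S m))) b * prod_f_R0 (fun k => a + b + 2 + INR k) (S m)
         / prod_f_R0 (fun k => a + 1 + INR k) (S m)) by (rewrite <- E1; field; lra).
      replace (bint 0 b) with (bint (INR (S (S m))) b * prod_f_R0 (fun k => b + 2 + INR k) (S m)
         / prod_f_R0 (fun k => 1 + INR k) (S m)) by (rewrite <- E2; field; lra).
      (* The exponents balance, (a + 1) + (b + 2) = (a + b + 2) + 1, so all powers of m + 1
         cancel. *)
      replace (Rpower (INR (S m)) (b + 2)) with (Rpower (INR (S m)) b * Rpower (INR (S m)) 2)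
        by (now rewrite Rpower_plus).
      replace (Rpower (INR (S m)) (a + b + 2))
        with (Rpower (INR (S m)) a * Rpower (INR (S m)) b * Rpower (INR (S m)) 2)
        by (now rewrite !Rpower_plus).
      rewrite Rpower_plus.
      assert (forall y, 0 < Rpower (INR (S m)) y) as Q by (intros; apply exp_pos).
      pose proof (Q a); pose proof (Q b); pose proof (Q 1); pose proof (Q 2).
      pose proof (INR_fact_lt_0 (S m)).
      pose proof (bint_nat_pos (S (S m)) b Hb).
      field; repeat split; lra. }
  rewrite E, bint_0, Gamma_1 by exact Hb.
  replace (b + 2) with (b + 1 + 1) by ring; rewrite (Gamma_succ (b + 1)) by lra.
  pose proof (Gamma_pos (a + b + 2) ltac:(lra)); field; lra.
Qed.

(** * Hankel determinants *)

From mathcomp Require Import all_boot all_fingroup all_algebra Rstruct.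
Set Implicit Arguments.
Unset Strict Implicit.
Unset Printing Implicit Defensive.
Import GRing.Theory.
Local Open Scope ring_scope.

Definition Hankel (F : comNzRingType) (n : nat) (mu : nat -> F) : 'M[F]_n :=
  \matrix_(i < n, j < n) mu (i + j)%N.

(** Replacing t by the product of s and t and reindexing the factors along s removes s from the
    inner sum; what is left is the Leibniz formula, repeated once for each of the n! permutations
    s. *)
Lemma sum_perm2_Hankel (F : comNzRingType) (n : nat) (mu : nat -> F) :
  \sum_(st : 'S_n * 'S_n) (-1) ^+ st.1 * (-1) ^+ st.2 * \prod_(i < n) mu (st.1 i + st.2 i)%N
  = n`!%:R * \det (Hankel n mu).
Proof.
rewrite -(pair_bigA _ (fun s t : 'S_n =>
  (-1) ^+ s * (-1) ^+ t * \prod_(i < n) mu (s i + t i)%N)) /=.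
have E (s : 'S_n) : \sum_(t : 'S_n) (-1) ^+ s * (-1) ^+ t * \prod_(i < n) mu (s i + t i)%N
    = \det (Hankel n mu).
  rewrite (reindex_inj (mulgI s)) /=; apply: eq_bigr => t _.
  rewrite odd_permM signr_addb signrMK; congr (_ * _).
  rewrite [RHS](reindex_inj (@perm_inj _ s)) /=.
  by apply: eq_bigr => i _; rewrite mxE permM.
by rewrite (eq_bigr _ (fun s _ => E s)) sumr_const card_Sn mulr_natl.
Qed.

Lemma sum_delta_ord (F : comNzRingType) (n k : nat) (x : F) (f : nat -> F) : (k < n)%N ->
  \sum_(j < n) x *+ (val j == k) * f j = x * f k.
Proof.
move=> kn; rewrite (bigD1 (Ordinal kn)) //= eqxx big1 ?addr0 // => j jk.
by rewrite -val_eqE /= in jk; rewrite (negbTE jk) mul0r.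
Qed.

(* Row i+1 is replaced by q_i * row (i+1) - p_i * row i, which clears the first column. *)
Lemma det_Hankel_rec (F : comNzRingType) (n : nat) (mu nu p q : nat -> F) :
  (forall i, p i * mu i = q i * mu i.+1) ->
  (forall i j, q i * mu (i + j).+2 - p i * mu (i + j).+1 = j.+1%:R * nu (i + j)%N) ->
  \prod_(i < n) q i * \det (Hankel n.+1 mu)
  = mu 0%N * \prod_(j < n) j.+1%:R * \det (Hankel n nu).
Proof.
move=> H0 H1.
pose B : 'M[F]_(1 + n) := \matrix_(i, j)
  (if val i is i'.+1 then q i' *+ (val j == i'.+1) - p i' *+ (val j == i') else (val j == 0%N)%:R).
have dB : \det B = \prod_(i < n) q i.
  rewrite det_trig; last first.
    apply/is_trig_mxP => i j; rewrite !mxE.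
    case: i => [[|i] Hi] /= ij; first by rewrite gtn_eqF.
    by rewrite (gtn_eqF ij) gtn_eqF ?subr0 //; apply: leq_trans ij; rewrite ltnW.
  rewrite big_ord_recl mxE /= mul1r; apply: eq_bigr => i _.
  by rewrite mxE /= !add0n eqxx eqn_leq ltnn /= subr0.
rewrite -dB -det_mulmx.
(* The factors j + 1 depend only on the column, so they leave the lower right block as a diagonal
   matrix. *)
pose D : 'rV[F]_n := \row_j j.+1%:R.
have -> : B *m Hankel n.+1 mu
  = block_mx (mu 0%N)%:M (\row_j mu j.+1) 0 (Hankel n nu *m diag_mx D) :> 'M_(1 + n).
  apply/matrixP => i k; rewrite mxE.
  have -> : \sum_j B i j * Hankel n.+1 mu j k = \sum_(j < n.+1)
    (if val i is i'.+1 then q i' *+ (val j == i'.+1) - p i' *+ (val j == i')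
     else 1 *+ (val j == 0%N)) * mu (j + k)%N.
    by apply: eq_bigr => j _; rewrite !mxE.
  case: (split_ordP i) => i' ->.
    rewrite [i']ord1 /=.
    rewrite (@sum_delta_ord _ _ _ _ (fun j => mu (j + k)%N)) // mul1r.
    case: (split_ordP k) => k' ->; first by rewrite block_mxEul [k']ord1 !mxE.
    by rewrite block_mxEur !mxE.
  rewrite /= !add0n.
  under eq_bigr do rewrite mulrBl.
  rewrite sumrB !(@sum_delta_ord _ _ _ _ (fun j => mu (j + k)%N)) // ?ltnS //; last exact: ltnW.
  case: (split_ordP k) => k' ->.
    by rewrite block_mxEdl [k']ord1 !mxE /= !addn0 H0 subrr.
  by rewrite block_mxEdr mul_mx_diag !mxE /= !addnS addSn H1 mulrC.
rewrite (det_ublock (mu 0%N)%:M) det_scalar1 det_mulmx det_diag mulrA mulrAC; congr (_ * _ * _).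
by apply: eq_bigr => j _; rewrite mxE.
Qed.

(** * Iterated integrals of squared Vandermonde determinants *)

Lemma integral_is_RInt (g : R -> R) (a b l : R) : is_RInt g a b l -> integral g a b = l.
Proof.
move=> H; rewrite /integral; case: excluded_middle_informative => [E|[]].
- by rewrite -RInt_Reals; exact: is_RInt_unique.
- by exists (ex_RInt_Reals_0 _ _ _ (ex_intro _ l H)).
Qed.

Lemma is_RInt_sum (I : Type) (s : seq I) (c : I -> R) (g : I -> R -> R) (a b : R) :
  (forall i, ex_RInt (g i) a b) ->
  is_RInt (fun x => \sum_(i <- s) c i * g i x) a b (\sum_(i <- s) c i * RInt (g i) a b).
Proof.
move=> Hg; elim: s => [|i s IH].
  rewrite big_nil; apply: (is_RInt_ext (V := R_NormedModule) (fun _ => 0)) => [x _|]; first by rewrite big_nil.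
  by have := is_RInt_const (V := R_NormedModule) a b 0; rewrite /scal /= /mult /= Rmult_0_r.
rewrite big_cons; apply: (is_RInt_ext (V := R_NormedModule) (fun x => Rplus (Rmult (c i) (g i x)) (\sum_(j <- s) c j * g j x))).
  by move=> x _; rewrite big_cons.
apply: (is_RInt_plus (V := R_NormedModule) (fun x => Rmult (c i) (g i x))) => //.
apply: (is_RInt_scal (V := R_NormedModule) (g i)); exact: (RInt_correct (V := R_CompleteNormedModule)).
Qed.

(** On finite sums of products of one-variable functions each integration consumes one factor of
    every term. Indexing [g] by natural numbers lets the induction peel off the head of the list by
    shifting k. *)
Lemma iter_int_sum_prod (I : finType) (n : nat) (a b : R) (c : I -> R)
    (g : I -> nat -> R -> R) (f : list R -> R) :
  (forall i k, ex_RInt (g i k) a b) ->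
  (forall l, size l = n -> f l = \sum_i c i * \prod_(k < n) g i k (nth 0 l k)) ->
  iter_int n a b f = \sum_i c i * \prod_(k < n) RInt (g i k) a b.
Proof.
elim: n c g f => [|n IH] c g f Hg Hf /=.
  by rewrite Hf //; apply: eq_bigr => i _; rewrite !big_ord0.
pose C i := c i * \prod_(k < n) RInt (g i k.+1) a b.
have -> : (fun x => iter_int n a b (fun l => f (x :: l))) = fun x => \sum_i C i * g i 0%N x.
  apply: functional_extensionality => x.
  rewrite (IH (fun i => c i * g i 0%N x) (fun i k => g i k.+1)) //.
    by apply: eq_bigr => i _; rewrite /C mulrAC.
  move=> l sl; rewrite Hf /= ?sl //; apply: eq_bigr => i _.
  by rewrite big_ord_recl /= mulrA.
rewrite (integral_is_RInt (@is_RInt_sum _ _ C (fun i => g i 0%N) a b (fun i => Hg i 0%N))).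
by apply: eq_bigr => i _; rewrite /C big_ord_recl mulrAC mulrA.
Qed.

Lemma vdm2_Vandermonde (l : list R) :
  vdm2 l = \det (Vandermonde (size l) (\row_(j < size l) nth 0 l j)) ^+ 2.
Proof.
rewrite det_Vandermonde; elim: l => [|x l IH]; first by rewrite /= big_ord0 expr1n.
rewrite [vdm2 _]/= IH big_ord_recl exprMn; congr (_ * _).
  rewrite big_mkcond big_ord_recl /= mul1r -prodrXl.
  rewrite (eq_bigr (fun j : 'I_(size l) => (nth 0 l j - x) ^+ 2)); last by move=> j _; rewrite !mxE.
  elim: l {IH} => [|y l IH] /=; first by rewrite big_ord0.
  by rewrite big_ord_recl /= -IH Rmult_1_r expr2.
congr (_ ^+ 2); apply: eq_bigr => i _.
rewrite [RHS]big_mkcond big_ord_recl /= mul1r -big_mkcond /=.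
by apply: eq_big => [j|j _]; rewrite ?mxE // ltnS.
Qed.

Lemma prod_weights (w : R -> R) (l : list R) :
  List.fold_right (fun x acc => Rmult (w x) acc) 1 l = \prod_(k < size l) w (nth 0 l k).
Proof. by elim: l => [|x l IH] /=; rewrite ?big_ord0 // big_ord_recl /= IH. Qed.

(** Heine's formula. The map [psi] keeps the change of variables inside the integrand, so
    substitution is carried out only in single integrals, and [c] holds the scale factor of the
    Vandermonde product. *)
Lemma iter_int_vdm2 (n : nat) (a b c : R) (psi w : R -> R) (f : list R -> R) :
  (forall k, ex_RInt (fun x => Rmult (pow (psi x) k) (w x)) a b) ->
  (forall l, size l = n -> f l = c * (vdm2 (map psi l) *
                           List.fold_right (fun x acc => Rmult (w x) acc) 1 l)) ->
  iter_int n a b f = c * (INR (fact n) *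
    \det (Hankel n (fun k => RInt (fun x => Rmult (pow (psi x) k) (w x)) a b))).
Proof.
move=> Hw Hf; rewrite INRE factE -sum_perm2_Hankel.
(* Extends a permutation to all natural indices, with value 0 outside the range, as
   [iter_int_sum_prod] expects. *)
pose e (s : 'S_n) k := oapp (fun i : 'I_n => val (s i)) 0%N (insub k).
have eE (s : 'S_n) (i : 'I_n) : e s i = s i by rewrite /e valK.
rewrite (@iter_int_sum_prod _ n a b (fun st : 'S_n * 'S_n => c * ((-1) ^+ st.1 * (-1) ^+ st.2))
  (fun st k x => Rmult (pow (psi x) (e st.1 k + e st.2 k)%N) (w x))) //.
  rewrite mulr_sumr; apply: eq_bigr => st _; rewrite -mulrA; congr (_ * (_ * _)).
    by apply: eq_bigr => i _; rewrite !eE.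
move=> l sl; rewrite Hf // prod_weights vdm2_Vandermonde size_map sl expr2.
set V := Vandermonde _ _.
have -> : \det V = \sum_(s : 'S_n) (-1) ^+ s * \prod_(k < n) psi (nth 0 l k) ^+ e s k.
  rewrite -det_tr; apply: eq_bigr => s _; congr (_ * _); apply: eq_bigr => i _.
  by rewrite !mxE eE (nth_map 0) // sl.
rewrite big_distrlr /= pair_bigA big_distrl mulr_sumr /=; apply: eq_bigr => st _.
rewrite mulrACA -!mulrA; do 3! congr (_ * _); rewrite -!big_split /=.
by apply: eq_bigr => k _; rewrite RpowE exprD mulrA.
Qed.

(** * Rescaling [t, 1] to [0, 1]: the moments *)

Local Open Scope R_scope.

(** Translation changes no difference; each of the n (n - 1) / 2 differences scales by s and enters
    squared. *)
Lemma vdm2_affine (t s : R) (l : list R) : s <> 0 ->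
  vdm2 l = s ^ (size l * (size l).-1) * vdm2 (map (fun x => (x - t) / s) l).
Proof.
move=> Hs; elim: l => [|x l IH]; first by rewrite /= Rmult_1_l.
have vE y r : vdm2 (y :: r) = List.fold_right (fun z acc => (z - y) ^ 2 * acc) 1 r * vdm2 r by [].
rewrite map_cons !vE IH.
have -> : List.fold_right (fun y acc => (y - x) ^ 2 * acc) 1 l = s ^ (size l).*2 *
  List.fold_right (fun y acc => (y - (x - t) / s) ^ 2 * acc) 1 (map (fun x => (x - t) / s) l).
  elim: l {IH} => [|y l IH]; first by rewrite /= Rmult_1_l.
  rewrite [LHS]/= IH -[size (y :: l)]/((size l).+1) doubleS.
  by move: (size l).*2 => N /=; field.
have -> : (size (x :: l) * (size (x :: l)).-1 = (size l).*2 + size l * (size l).-1)%N.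
  rewrite -[size (x :: l)]/((size l).+1); case: (size l) => // m.
  by rewrite -muln2 -mulnDr add2n mulnC.
by rewrite pow_add; ring.
Qed.

Definition moment (t alpha beta : R) (k : nat) : R :=
  RInt (fun y => y ^ k * (powr (t + (1 - t) * y) alpha * powr (1 - y) beta)) 0 1.

Lemma continuous_moment (t alpha beta : R) (k : nat) (x : R) : 0 < alpha -> 0 < beta ->
  continuous (fun y => y ^ k * (powr (t + (1 - t) * y) alpha * powr (1 - y) beta)) x.
Proof.
move=> Ha Hb.
apply: (continuous_mult (fun y => y ^ k)).
  by apply: (ex_derive_continuous (fun y => y ^ k)); auto_derive.
apply: (continuous_mult (fun y => powr (t + (1 - t) * y) alpha)); last exact: continuous_powr_1m.
apply: (continuous_comp (fun y => t + (1 - t) * y) (fun z => powr z alpha)).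
  by apply: (ex_derive_continuous (fun y => t + (1 - t) * y)); auto_derive.
exact: continuous_powr.
Qed.

Lemma is_RInt_moment_scaled (t alpha beta : R) (k : nat) : 0 < alpha -> 0 < beta -> t < 1 ->
  is_RInt (fun x => ((x - t) / (1 - t)) ^ k * (powr x alpha * powr (1 - x) beta)) t 1
    (Rpower (1 - t) (1 + beta) * moment t alpha beta k).
Proof.
move=> Ha Hb Ht.
pose u := / (1 - t); pose v := - t / (1 - t).
have Hu : 0 < u by apply: Rinv_0_lt_compat; lra.
have Eu : u * t + v = 0 by rewrite /u /v; field; lra.
have Ev : u * 1 + v = 1 by rewrite /u /v; field; lra.
have E : is_RInt (fun y => y ^ k * (powr (t + (1 - t) * y) alpha * powr (1 - y) beta))
    (u * t + v) (u * 1 + v) (moment t alpha beta k).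
  rewrite Eu Ev; apply: (RInt_correct (V := R_CompleteNormedModule)).
  by apply: ex_RInt_continuous_01 => x; exact: continuous_moment.
move/(is_RInt_comp_lin (V := R_NormedModule)): E => E.
have := is_RInt_scal (V := R_NormedModule) _ _ _ (Rpower (1 - t) (1 + beta)) _ E.
apply: is_RInt_ext => x _; rewrite /scal /= /mult /=.
have -> : u * x + v = (x - t) / (1 - t) by rewrite /u /v; field; lra.
have -> : t + (1 - t) * ((x - t) / (1 - t)) = x by field; lra.
have -> : powr (1 - x) beta = Rpower (1 - t) beta * powr (1 - (x - t) / (1 - t)) beta.
  by rewrite -powr_mult; [congr powr; field; lra|lra].
by rewrite Rpower_plus Rpower_1 /u; [real_eq; field; lra|lra].
Qed.

Lemma det_Hankel_scale (n : nat) (c : R) (mu : nat -> R) :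
  \det (Hankel n (fun k => c * mu k)) = c ^ n * \det (Hankel n mu).
Proof.
have -> : Hankel n (fun k => c * mu k) = (c *: Hankel n mu)%R by apply/matrixP => i j; rewrite !mxE.
by rewrite detZ RpowE.
Qed.

Lemma Dn_moment (n : nat) (alpha beta t : R) : 0 < alpha -> 0 < beta -> t < 1 ->
  Dn n alpha beta t =
    Rpower (1 - t) (INR n * (INR n + beta)) * \det (Hankel n (moment t alpha beta)).
Proof.
move=> Ha Hb Ht; rewrite /Dn.
pose w x := powr x alpha * powr (1 - x) beta.
have Hm k := @is_RInt_moment_scaled t alpha beta k Ha Hb Ht.
rewrite (@iter_int_vdm2 n t 1 ((1 - t) ^ (n * n.-1)) (fun x => (x - t) / (1 - t)) w).
- have -> : (fun k => RInt (fun x => ((x - t) / (1 - t)) ^ k * w x) t 1) =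
    (fun k => Rpower (1 - t) (1 + beta) * moment t alpha beta k).
    by apply: functional_extensionality => k; apply: is_RInt_unique; exact: Hm.
  rewrite det_Hankel_scale.
  (* The exponent is n (n - 1) from the Vandermonde factor plus n (1 + beta) from the n moments. *)
  have -> : Rpower (1 - t) (INR n * (INR n + beta))
          = (1 - t) ^ (n * n.-1) * Rpower (1 - t) (1 + beta) ^ n.
    rewrite -!Rpower_pow; try exact: exp_pos; try lra.
    rewrite Rpower_mult -Rpower_plus; congr Rpower.
    case: n => [|n]; first by rewrite /=; lra.
    by rewrite [n.+1.-1]/= mult_INR S_INR; ring.
  rewrite -?RmultE; field; exact: INR_fact_neq_0.
- by move=> k; eexists; exact: Hm.
- move=> l sl; rewrite (@vdm2_affine t (1 - t) l); last lra.
  by rewrite sl; exact: Rmult_assoc.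
Qed.

Lemma moment_0 (alpha beta : R) (k : nat) : moment 0 alpha beta k = bint (alpha + INR k) beta.
Proof.
apply: bint_ext => x Hx.
have -> : 0 + (1 - 0) * x = x by ring.
rewrite !(powr_pos_eq x); try lra.
rewrite Rpower_plus Rpower_pow; [ring|lra].
Qed.

Lemma ex_RInt_moment (t alpha beta : R) (k : nat) : 0 < alpha -> 0 < beta ->
  ex_RInt (fun y => y ^ k * (powr (t + (1 - t) * y) alpha * powr (1 - y) beta)) 0 1.
Proof. by move=> Ha Hb; apply: ex_RInt_continuous_01 => x; exact: continuous_moment. Qed.

(** On the unit interval t + (1 - t) y lies between t and 1, so the only factor depending on t is
    between t^alpha and 1. This squeeze replaces a convergence theorem for integrals. *)
Lemma moment_bounds (t alpha beta : R) (k : nat) : 0 < alpha -> 0 < beta -> 0 < t < 1 ->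
  Rpower t alpha * bint (INR k) beta <= moment t alpha beta k <= bint (INR k) beta.
Proof.
move=> Ha Hb Ht; have Hk := pos_INR k.
have P x : 0 < x < 1 -> Rpower t alpha <= powr (t + (1 - t) * x) alpha <= 1.
  move=> Hx; have Hx' : 0 < (1 - t) * x by apply: Rmult_lt_0_compat; lra.
  have Hx2 : 0 < (1 - t) * (1 - x) by apply: Rmult_lt_0_compat; lra.
  rewrite powr_pos_eq; last lra.
  split; first by apply: Rle_Rpower_l; lra.
  have E1 : Rpower 1 alpha = 1 by rewrite /Rpower ln_1 Rmult_0_r exp_0.
  apply: Rle_trans (Req_le _ _ E1); apply: Rle_Rpower_l; lra.
have W x : 0 < x < 1 -> 0 <= x ^ k * powr (1 - x) beta.
  by move=> Hx; apply: Rmult_le_pos; [apply: pow_le; lra|exact: powr_ge_0].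
have B x : 0 < x < 1 -> powr x (INR k) * powr (1 - x) beta = x ^ k * powr (1 - x) beta.
  by move=> Hx; rewrite powr_pos_eq ?Rpower_pow //; lra.
split.
- have -> : Rpower t alpha * bint (INR k) beta =
    RInt (fun x => Rpower t alpha * (powr x (INR k) * powr (1 - x) beta)) 0 1.
    symmetry; apply: (RInt_scal (V := R_CompleteNormedModule)); exact: ex_bint.
  apply: RInt_le; [lra| |exact: ex_RInt_moment|].
    apply: (ex_RInt_scal (V := R_NormedModule) (fun x => powr x (INR k) * powr (1 - x) beta)).
    exact: ex_bint.
  move=> x Hx; rewrite B //.
  have := Rmult_le_compat_l _ _ _ (W x Hx) (proj1 (P x Hx)); lra.
- apply: RInt_le; [lra|exact: ex_RInt_moment|exact: ex_bint|].
  move=> x Hx; rewrite B //.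
  have := Rmult_le_compat_l _ _ _ (W x Hx) (proj2 (P x Hx)); lra.
Qed.

(** * The limit t -> 1 *)

Lemma filterlim_R_mult (T : Type) (F : (T -> Prop) -> Prop) (FF : Filter F)
    (f g : T -> R) (x y : R) :
  filterlim f F (locally x) -> filterlim g F (locally y) ->
  filterlim (fun t => f t * g t) F (locally (x * y)).
Proof.
move=> Hf Hg; apply: (filterlim_comp_2 f g Rmult Hf Hg).
exact: (filterlim_mult (K := R_AbsRing)).
Qed.

Lemma filterlim_R_plus (T : Type) (F : (T -> Prop) -> Prop) (FF : Filter F)
    (f g : T -> R) (x y : R) :
  filterlim f F (locally x) -> filterlim g F (locally y) ->
  filterlim (fun t => f t + g t) F (locally (x + y)).
Proof.
move=> Hf Hg; apply: (filterlim_comp_2 f g Rplus Hf Hg).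
exact: (filterlim_plus (V := R_NormedModule)).
Qed.

Lemma filterlim_big (T I : Type) (F : (T -> Prop) -> Prop) (FF : Filter F)
    (op : R -> R -> R) (idx : R) (s : seq I) (f : I -> T -> R) (l : I -> R) :
  (forall (g h : T -> R) (x y : R), filterlim g F (locally x) -> filterlim h F (locally y) ->
     filterlim (fun t => op (g t) (h t)) F (locally (op x y))) ->
  (forall i, filterlim (f i) F (locally (l i))) ->
  filterlim (fun t => \big[op/idx]_(i <- s) f i t) F (locally (\big[op/idx]_(i <- s) l i)).
Proof.
move=> Hop Hf; elim: s => [|i s IH].
  rewrite big_nil; apply: (filterlim_ext (fun _ => idx)); last exact: filterlim_const.
  by move=> t; rewrite big_nil.
rewrite big_cons.
apply: (filterlim_ext (fun t => op (f i t) (\big[op/idx]_(j <- s) f j t))).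
  by move=> t; rewrite big_cons.
exact: Hop.
Qed.

Lemma filterlim_det_Hankel (T : Type) (F : (T -> Prop) -> Prop) (FF : Filter F) (n : nat)
    (mu : T -> nat -> R) (nu : nat -> R) :
  (forall k, filterlim (fun t => mu t k) F (locally (nu k))) ->
  filterlim (fun t => \det (Hankel n (mu t))) F (locally (\det (Hankel n nu))).
Proof.
move=> H; rewrite /determinant.
apply: filterlim_big => [g h x y|s]; first exact: filterlim_R_plus.
apply: filterlim_R_mult; first exact: filterlim_const.
apply: filterlim_big => [g h x y|i]; first exact: filterlim_R_mult.
rewrite mxE; apply: filterlim_ext (H _) => t; by rewrite mxE.
Qed.

Lemma moment_lim (alpha beta : R) (k : nat) : 0 < alpha -> 0 < beta ->
  filterlim (fun t => moment t alpha beta k) (at_left 1) (locally (bint (INR k) beta)).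
Proof.
move=> Ha Hb.
apply: (@filterlim_le_le _ (at_left 1) _ (fun t => Rpower t alpha * bint (INR k) beta) _
  (fun _ => bint (INR k) beta) (Rbar.Finite (bint (INR k) beta))).
(* Radius 1 forces t > 0, as [moment_bounds] demands. *)
- exists (mkposreal 1 Rlt_0_1) => t Ht Ht1; apply: moment_bounds => //.
  have /Rabs_def2 ? : Rabs (t - 1) < 1 by exact: Ht.
  by lra.
- have L : filterlim (fun t => Rpower t alpha * bint (INR k) beta) (locally 1)
      (locally (Rpower 1 alpha * bint (INR k) beta)).
    apply: filterlim_R_mult; last exact: filterlim_const.
    apply: (ex_derive_continuous (fun t => Rpower t alpha)).
    by rewrite /Rpower; auto_derive; lra.
  rewrite {2}/Rpower ln_1 Rmult_0_r exp_0 Rmult_1_l in L.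
  apply: filterlim_filter_le_1 L; exact: filter_le_within.
- exact: filterlim_const.
Qed.

(** * Evaluation of the determinant *)

(* Squared norm of the j-th monic Jacobi polynomial for the weight x^a (1-x)^b on [0,1]. *)
Definition jacobi_norm (a b : R) (j : nat) : R :=
  Gamma (INR j + 1) * Gamma (a + b + 1 + INR j) * Gamma (a + INR j + 1) * Gamma (b + INR j + 1)
  / (Gamma (a + b + 1 + 2 * INR j) * Gamma (a + b + 2 * INR j + 2)).

Lemma jacobi_norm_pos (a b : R) (j : nat) : 0 <= a -> 0 < b -> 0 < jacobi_norm a b j.
Proof.
move=> Ha Hb; have := pos_INR j => Hj; apply: Rdiv_lt_0_compat;
  repeat apply: Rmult_lt_0_compat; apply: Gamma_pos; lra.
Qed.

Lemma jacobi_norm_0 (a b : R) : 0 <= a -> 0 < b -> jacobi_norm a b 0 = bint a b.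
Proof.
move=> Ha Hb; rewrite /jacobi_norm bint_Gamma //= Rmult_0_r !Rplus_0_r Rplus_0_l Gamma_1.
have := Gamma_pos (a + b + 1); have := Gamma_pos (a + b + 2) => H1 H2.
by field; split; apply: Rgt_not_eq; [apply: H1|apply: H2]; lra.
Qed.

(** Reflects that the derivative of the monic Jacobi polynomial of degree j + 1 for (a, b) is j + 1
    times the one of degree j for (a + 1, b + 1). *)
Lemma jacobi_norm_succ (a b : R) (j : nat) : 0 <= a -> 0 < b ->
  (a + b + 2 + INR j) * jacobi_norm a b j.+1 = INR j.+1 * jacobi_norm (a + 1) (b + 1) j.
Proof.
move=> Ha Hb; have Hj := pos_INR j; rewrite /jacobi_norm S_INR.
rewrite (Gamma_succ (INR j + 1)); last lra.
have -> : Gamma (a + 1 + (b + 1) + 1 + INR j)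
    = (a + b + 2 + INR j) * Gamma (a + b + 1 + (INR j + 1)).
  rewrite -(Rplus_assoc (a + b + 1)).
  have -> : a + 1 + (b + 1) + 1 + INR j = a + b + 1 + INR j + 1 + 1 by ring.
  by rewrite (Gamma_succ (a + b + 1 + INR j + 1)); [congr (_ * _); ring|lra].
have -> : a + 1 + INR j + 1 = a + (INR j + 1) + 1 by ring.
have -> : b + 1 + INR j + 1 = b + (INR j + 1) + 1 by ring.
have -> : a + 1 + (b + 1) + 1 + 2 * INR j = a + b + 1 + 2 * (INR j + 1) by ring.
have -> : a + 1 + (b + 1) + 2 * INR j + 2 = a + b + 2 * (INR j + 1) + 2 by ring.
have H1 : 0 < Gamma (a + b + 1 + 2 * (INR j + 1)) by apply: Gamma_pos; lra.
have H2 : 0 < Gamma (a + b + 2 * (INR j + 1) + 2) by apply: Gamma_pos; lra.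
by field; lra.
Qed.

Theorem det_Hankel_bint (n : nat) (a b : R) : 0 <= a -> 0 < b ->
  \det (Hankel n (fun k => bint (a + INR k) b)) = (\prod_(j < n) jacobi_norm a b j)%R.
Proof.
elim: n a b => [|n IH] a b Ha Hb; first by rewrite det_mx00 big_ord0.
(* [q i] and a + 1 + i are the coefficients of [bint_succ_l] at a + i, which is why the first column
   is cleared. *)
pose q i : R := a + b + 2 + INR i.
have Hq i : 0 < q i by rewrite /q; have := pos_INR i; lra.
have := @det_Hankel_rec R n (fun k => bint (a + INR k) b)
  (fun k => bint (a + 1 + INR k) (b + 1)) (fun i => a + 1 + INR i) q.
rewrite IH; try lra.
move=> H.
apply: (Rmult_eq_reg_l (\prod_(i < n) q i)%R); last first.
  apply/eqP; apply/prodf_neq0 => i _; apply/eqP; exact: Rgt_not_eq.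
rewrite -[LHS]/((\prod_(i < n) q i)%R * \det _)%R.
rewrite H.
- rewrite Rplus_0_r big_ord_recl jacobi_norm_0 // -mulrA -big_split /= RmultE mulrCA.
  congr (_ * _)%R; rewrite -big_split /=; apply: eq_bigr => i _.
  rewrite -INRE -!RmultE -jacobi_norm_succ //.
- move=> i; rewrite -!RmultE S_INR; have Hi := pos_INR i.
  have := @bint_succ_l (a + INR i) b; rewrite /q => E.
  rewrite -(Rplus_assoc a).
  have -> : a + 1 + INR i = a + INR i + 1 by ring.
  by rewrite -E; [real_eq; ring|lra|lra].
(* With c = a + 1 + i + j both coefficients fall short by j + 1 of those in [bint_succ_l] at c. The
   remainder (j + 1) (bint c b - bint (c + 1) b) is (j + 1) times bint c (b + 1). *)
- move=> i j; rewrite -INRE -!RmultE /q !S_INR.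
  have Hi := pos_INR i; have Hj := pos_INR j.
  rewrite plus_INR bint_succ_r; try lra.
  set c := a + 1 + (INR i + INR j).
  have -> : a + (INR i + INR j + 1) = c by rewrite /c; ring.
  have -> : a + (INR i + INR j + 1 + 1) = c + 1 by rewrite /c; ring.
  have E := @bint_succ_l c b; rewrite -RminusE.
  have {}E : (c + b + 2) * bint (c + 1) b = (c + 1) * bint c b by apply: E; rewrite /c; lra.
  have -> : a + b + 2 + INR i = c + b + 2 - (INR j + 1) by rewrite /c; ring.
  have -> : a + 1 + INR i = c + 1 - (INR j + 1) by rewrite /c; ring.
  by rewrite !Rmult_minus_distr_r E; real_eq; ring.
Qed.

(** With z = n + (a + b + 1) / 2, the denominator grows by z Gamma(z)^2 Gamma(z + 1/2)^2, and
    duplication turns this into Gamma(2 z) Gamma(2 z + 1), the denominator of [jacobi_norm]. [kappa]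
    occurs to the fourth power above and below. *)
Lemma Kfun_succ : exists c : R, 0 < c /\ forall (a b : R) (n : nat), 0 <= a -> 0 < b ->
  Kfun a b n.+1 = Kfun a b n * (c * Rpower 2 (4 * INR n + 2 * a + 2 * b) * jacobi_norm a b n).
Proof.
have [kappa [Hk HG]] := BarnesG_succ; have [c [Hc HD]] := Gamma_duplication.
(* Duplication makes that growth (c^2 / 2) 2^(-4 z) Gamma(2 z) Gamma(2 z + 1); since 4 z = 4 n + 2 a
   + 2 b + 2, the constant is 2 * 4 / c^2. *)
exists (8 / c ^ 2); split; first by apply: Rdiv_lt_0_compat; [lra|exact: pow_lt].
move=> a b n Ha Hb; rewrite /Kfun /jacobi_norm S_INR; cbv zeta.
have HN := pos_INR n; move: (INR n) HN => N HN.
pose z := N + (a + b + 1) / 2.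
have Hz : 0 < z by rewrite /z; lra.
have -> : N + (a + b + 1) / 2 = z by [].
have -> : N + 1 + (a + b + 1) / 2 = z + 1 by rewrite /z; ring.
have -> : N + 1 + (a + b) / 2 = z + / 2 by rewrite /z; field.
have -> : N + 1 + 1 + (a + b) / 2 = z + / 2 + 1 by rewrite /z; field.
have -> : N + 1 + a + 1 = N + a + 1 + 1 by ring.
have -> : N + 1 + b + 1 = N + b + 1 + 1 by ring.
have -> : N + 1 + a + b + 1 = N + a + b + 1 + 1 by ring.
have -> : a + b + 1 + N = N + a + b + 1 by ring.
have -> : a + N + 1 = N + a + 1 by ring.
have -> : b + N + 1 = N + b + 1 by ring.
have -> : a + b + 1 + 2 * N = 2 * z by rewrite /z; field.
have -> : a + b + 2 * N + 2 = 2 * z + 1 by rewrite /z; field.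
rewrite (HG (N + 1)); last lra.
rewrite (HG (N + a + 1)); last lra.
rewrite (HG (N + b + 1)); last lra.
rewrite (HG (N + a + b + 1)); last lra.
rewrite (HG z) // (HG (z + / 2)); last lra.
rewrite (Gamma_succ z) // (Gamma_succ (2 * z)); last lra.
have -> : 4 * N + 2 * a + 2 * b = 2 * z + 2 * z - 2 by rewrite /z; field.
have -> : Rpower 2 (2 * z + 2 * z - 2) = Rpower 2 (2 * z) ^ 2 / 4.
  rewrite /Rminus !Rpower_plus Rpower_Ropp.
  have -> : Rpower 2 2 = 4 by rewrite (Rpower_pow 2); [ring|lra].
  by field.
have P2 : 0 < Rpower 2 (2 * z) by exact: exp_pos.
have E := HD z Hz; rewrite Rpower_Ropp in E.
have P1 x : 0 < x -> Gamma x <> 0 by move=> Hx; apply: Rgt_not_eq; exact: Gamma_pos.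
have G1 x : 0 < x -> BarnesG x <> 0 by move=> Hx; apply: Rgt_not_eq; exact: BarnesG_pos.
have -> : Gamma (2 * z) = Gamma z * Gamma (z + / 2) * Rpower 2 (2 * z) / c.
  by rewrite E; field; lra.
field; repeat split; try lra; try (apply: P1; lra); try (apply: G1; lra).
Qed.

(** [Ffun] is the normalisation under which the product at n = 0 collapses to G(1). Each step in n
    contributes 2^(2 a), the origin of 2^(2 n alpha) in the theorem; [E] collects what is free of a
    and cancels in the quotient. *)
Lemma Ffun_Kfun : exists E : R -> nat -> R, (forall b n, 0 < E b n) /\
  forall (a b : R) (n : nat), 0 <= a -> 0 < b ->
  Ffun a b * Kfun a b n
  = E b n * Rpower 2 (2 * INR n * a) * (\prod_(j < n) jacobi_norm a b j)%R.
Proof.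
have [c [Hc HK]] := Kfun_succ.
pose E b := fix E n := if n is m.+1 then E m * (c * Rpower 2 (4 * INR m + 2 * b))
                       else BarnesG 1.
exists E; split.
  move=> b; elim=> [|n IH] /=; first by apply: BarnesG_pos; lra.
  by apply: Rmult_lt_0_compat => //; apply: Rmult_lt_0_compat => //; exact: exp_pos.
move=> a b n Ha Hb; elim: n => [|n IH].
  rewrite big_ord0 /= Rmult_0_r Rmult_0_l Rpower_O; last lra.
  rewrite -R1E /Kfun /Ffun /= !Rplus_0_l.
  have G1 x : 0 < x -> BarnesG x <> 0 by move=> Hx; apply: Rgt_not_eq; exact: BarnesG_pos.
  have P1 x : 0 < x -> Gamma x <> 0 by move=> Hx; apply: Rgt_not_eq; exact: Gamma_pos.
  field; repeat split; first [by apply: G1; lra|by apply: P1; lra|lra].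
rewrite HK // -Rmult_assoc IH big_ord_recr S_INR /= -RmultE.
have -> : 2 * (INR n + 1) * a = 2 * INR n * a + 2 * a by ring.
rewrite !Rpower_plus; real_eq; ring.
Qed.

Theorem theorem1p2 (alpha beta : R) (n : nat) :
  0 < alpha -> 0 < beta -> (1 <= n)%coq_nat ->
  forall eps : R, eps > 0 ->
  exists delta : R, delta > 0 /\
    forall t : R, 1 - delta < t < 1 ->
      Rabs ((Dn n alpha beta t / Dn n alpha beta 0) / asym_rhs n alpha beta t - 1) < eps.
Proof.
move=> Ha Hb _ eps Heps.
have [E [HE HFK]] := Ffun_Kfun.
pose h a := (\prod_(j < n) jacobi_norm a beta j)%R.
have hpos a : 0 <= a -> 0 < h a.
  move=> Ha'; rewrite /h; apply: (big_ind (fun x => 0 < x)) => [|x y|j _].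
  - exact: Rlt_0_1.
  - exact: Rmult_lt_0_compat.
  - exact: jacobi_norm_pos.
have h0 := hpos 0 (Rle_refl 0); have ha := hpos alpha (Rlt_le _ _ Ha).
have D0 : Dn n alpha beta 0 = h alpha.
  rewrite Dn_moment //; last lra.
  have -> : moment 0 alpha beta = fun k => bint (alpha + INR k) beta.
    by apply: functional_extensionality => k; exact: moment_0.
  rewrite det_Hankel_bint //; last lra.
  by rewrite Rminus_0_r /Rpower ln_1 Rmult_0_r exp_0 Rmult_1_l.
have L : filterlim (fun t => \det (Hankel n (moment t alpha beta))) (at_left 1) (locally (h 0)).
  rewrite /h -det_Hankel_bint //; last lra.
  apply: filterlim_det_Hankel => k; rewrite Rplus_0_l; exact: moment_lim.
(* An exact identity for every t < 1: [E], the powers of 2 and the power of 1 - t all cancel,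
   leaving only the limit [L]. *)
have Q t : t < 1 -> (Dn n alpha beta t / Dn n alpha beta 0) / asym_rhs n alpha beta t
    = \det (Hankel n (moment t alpha beta)) / h 0.
  move=> Ht; rewrite D0 Dn_moment // /asym_rhs !HFK; try lra.
  rewrite Rmult_0_r Rpower_O; last lra.
  rewrite -/(h 0) -/(h alpha); move: (\det _) => d.
  have HE' := HE beta n.
  have P1 : 0 < Rpower (1 - t) (INR n * (INR n + beta)) by exact: exp_pos.
  have P2 : 0 < Rpower 2 (2 * INR n * alpha) by exact: exp_pos.
  by real_eq; field; repeat split; lra.
have Heps' : 0 < eps * h 0 by exact: Rmult_lt_0_compat.
have [delta Hd] := L _ (locally_ball (h 0) (mkposreal _ Heps')).
exists delta; split; first exact: cond_pos.
move=> t [Ht1 Ht2]; rewrite Q //.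
have Hball : Rabs (\det (Hankel n (moment t alpha beta)) - h 0) < eps * h 0.
  by apply: Hd => //; apply: Rabs_def1; rewrite /Hierarchy.minus /Hierarchy.plus /Hierarchy.opp /=; lra.
move: Hball; move: (\det _) => d Hball.
have -> : d / h 0 - 1 = (d - h 0) / h 0 by field; lra.
rewrite /Rdiv Rabs_mult Rabs_inv (Rabs_pos_eq (h 0)); last lra.
apply: (Rmult_lt_reg_r (h 0)) => //.
by rewrite Rmult_assoc Rinv_l; lra.
Qed.
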